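(* Let $A$ be an $n\times n$ matrix with entries in $\{0,1\}$ and no zero rows, and let $X_A$ be the one-sided shift space $$X_A=\{(x_i)_{i\in\mathbb N_0}\in\{1,2,\dots,n\}^{\mathbb N_0}\mid \forall i\in\mathbb N_0:\ A(x_i,x_{i+1})=1\}.$$ Then $\mathcal D_{X_A}\rtimes_{\alpha,\mathcal L}\mathbb N$ is generated by partial isometries $\{S_i\}_{i\in\{1,\dots,n\}}$ that satisfy $$\sum_{j=1}^nS_jS_j^*=I\qquad\text{and}\qquad S_i^*S_i=\sum_{j=1}^nA(i,j)S_jS_j^*\ \text{ for every } i\in\{1,\dots,n\}.$$ Moreover, if $B$ is a unital $C^*$-algebra such that there exists a set of partial isometries $\{T_i\}_{i\in\{1,\dots,n\}}$ in $B$ satisfying $$\sum_{j=1}^nT_jT_j^*=I\qquad\text{and}\qquad T_i^*T_i=\sum_{j=1}^nA(i,j)T_jT_j^*\ \text{ for every } i\in\{1,\dots,n\},$$ then there exists a $*$-homomorphism from $\mathcal D_{X_A}\rtimes_{\alpha,\mathcal L}\mathbb N$ to $B$ sending $S_i$ to $T_i$ for every $i\in\{1,\dots,n\}$.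
   Context: $I$ denotes the unit of the $C^*$-algebra in question. **Shift spaces.** $\mathfrak a$ is a finite set with the discrete topology, $\mathbb N_0=\{0,1,2,\dots\}$, and $\mathfrak a^{\mathbb N_0}$ has the product topology. The shift is $(\sigma(x))_i=x_{i+1}$. A one-sided shift space is a closed subset $X\subseteq\mathfrak a^{\mathbb N_0}$ with $\sigma(X)\subseteq X$; $\sigma$ also denotes its restriction to $X$. **The algebra $\mathcal D_X$.** For bounded functions $f:X\to\mathbb C$ put $\alpha(f)=f\circ\sigma$ and $\mathcal L(f)(x)=\frac1{\#\sigma^{-1}(\{x\})}\sum_{y\in\sigma^{-1}(\{x\})}f(y)$ if $x\in\sigma(X)$, $\mathcal L(f)(x)=0$ if $x\notin\sigma(X)$. $\mathcal D_X$ is the smallest $C^*$-subalgebra of the $C^*$-algebra of bounded functions on $X$ that contains $C(X)$ and is closed under $\mathcal L$ and $\alpha$. **Exel's crossed product.** Let $D$ be a unital $C^*$-algebra, $\alpha:D\to D$ a $*$-endomorphism, and $\mathcal L:D\to D$ a transfer operator, i.e. a continuous positive linear map with $\mathcal L(\alpha(a)b)=a\mathcal L(b)$ for all $a,b\in D$. $\mathcal T(D,\alpha,\mathcal L)$ is the universal unital $C^*$-algebra generated by a copy of $D$ and an element $S$ subject to $Sa=\alpha(a)S$ and $S^*aS=\mathcal L(a)$ for all $a\in D$; the canonical map from $D$ is injective. A redundancy is a pair $(a,k)\in D\times\overline{DSS^*D}$ (closed linear span) with $abS=kbS$ for all $b\in D$. The crossed product $D\rtimes_{\alpha,\mathcal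 L}\mathbb N$ is the quotient of $\mathcal T(D,\alpha,\mathcal L)$ by the closed two-sided ideal generated by all differences $a-k$, where $(a,k)$ is a redundancy with $a\in\overline{D\alpha(D)D}$. *)

(* Defs.v *)
From HB Require Import structures.
From mathcomp Require Import all_boot all_order all_algebra finmap.
From mathcomp Require Import complex.
From mathcomp Require Import all_classical all_reals.
From mathcomp Require Import topology normedtype.
From mathcomp Require Import ring lra.

Set Implicit Arguments.
Unset Strict Implicit.
Unset Printing Implicit Defensive.

Import Order.TTheory GRing.Theory Num.Theory numFieldNormedType.Exports.

Local Open Scope classical_set_scope.
Local Open Scope ring_scope.
Local Open Scope complex_scope.

(* Unital C*-algebras over R[i]; the zero algebra is allowed. The unit and the
   product are fields of the mixin because the library has no common extension
   of rings and normed modules other than number domains; the ring structure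
   is put back below, so that the usual ring notations and lemmas apply. *)
HB.mixin Record isCStarAlgebra (R : realType) A
    of CompleteNormedModule R[i] A := {
  cone : A;
  cmul : A -> A -> A;
  star : A -> A;
  cmulA : associative cmul;
  cmul1l : left_id cone cmul;
  cmul1r : right_id cone cmul;
  cmulDl : left_distributive cmul +%R;
  cmulDr : right_distributive cmul +%R;
  cmulZl : forall (c : R[i]) (x y : A), cmul (c *: x) y = c *: cmul x y;
  cmulZr : forall (c : R[i]) (x y : A), cmul x (c *: y) = c *: cmul x y;
  starD : {morph star : x y / x + y};
  starZ : forall (c : R[i]) (x : A), star (c *: x) = c^* *: star x;
  cstarM : forall x y : A, star (cmul x y) = cmul (star y) (star x);
  starK : involutive star;
  cmul_norm_le : forall x y : A, `|cmul x y| <= `|x| * `|y|;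
  cstar_norm : forall x : A, `|cmul (star x) x| = `|x| ^+ 2
}.

#[short(type="cStarAlgType")]
HB.structure Definition CStarAlgebra (R : realType) :=
  {A of CompleteNormedModule R[i] A & isCStarAlgebra R A}.

HB.instance Definition _ (R : realType) (A : cStarAlgType R) :=
  @GRing.Zmodule_isPzRing.Build (CStarAlgebra.sort A) cone cmul
    (@cmulA R A) (@cmul1l R A) (@cmul1r R A) (@cmulDl R A) (@cmulDr R A).

Section CStarTheory.
Context {R : realType} {A : cStarAlgType R}.
Implicit Types (c : R[i]) (x y : A).

Lemma starM x y : star (x * y) = star y * star x.
Proof. exact: cstarM. Qed.

Lemma norm_mul_le x y : `|x * y| <= `|x| * `|y|.
Proof. exact: cmul_norm_le. Qed.

Lemma norm_star_mul x : `|star x * x| = `|x| ^+ 2.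
Proof. exact: cstar_norm. Qed.

Lemma csclAl c x y : (c *: x) * y = c *: (x * y).
Proof. exact: cmulZl. Qed.

Lemma csclAr c x y : x * (c *: y) = c *: (x * y).
Proof. exact: cmulZr. Qed.

End CStarTheory.

Section CStarNotions.
Context {R : realType}.
Implicit Types A B : cStarAlgType R.

(* Neither unitality nor continuity is required (the latter is automatic). *)
Definition star_hom A B (f : A -> B) : Prop :=
  [/\ forall (c : R[i]) x y, f (c *: x + y) = c *: f x + f y,
      {morph f : x y / x * y} & {morph f : x / star x}].

Definition projection A (p : A) : Prop := star p = p /\ p * p = p.

Definition partial_isometry A (s : A) : Prop := projection (star s * s).

Definition positive A (a : A) : Prop := exists b : A, a = star b * b.

Definition closed_subspace A (V : set A) : Prop :=
  [/\ V 0, forall (c : R[i]) x y, V x -> V y -> V (c *: x + y) & closed V].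

Definition cstar_subalg A (V : set A) : Prop :=
  [/\ closed_subspace V, forall x y, V x -> V y -> V (x * y)
    & forall x, V x -> V (star x)].

Definition closed_ideal A (V : set A) : Prop :=
  closed_subspace V /\ (forall a x, V x -> V (a * x) /\ V (x * a)).

Definition closed_span A (G : set A) : set A := smallest (@closed_subspace A) G.

Definition cstar_generated A (G : set A) : set A := smallest (@cstar_subalg A) G.

Definition ideal_generated A (G : set A) : set A := smallest (@closed_ideal A) G.

End CStarNotions.

Section Complete.
Variable R : realType.

Definition cabs (z : R[i]) : R := complex.Re `|z|.

Lemma cabsE (z : R[i]) : `|z| = (cabs z)%:C.
Proof. by rewrite /cabs RRe_real// ger0_real. Qed.

Lemma cabs_ge0 z : 0 <= cabs z.
Proof. by rewrite -ler0c -cabsE. Qed.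

Lemma cabs_Re (z : R[i]) : `|complex.Re z| <= cabs z.
Proof. by rewrite -lecR -cabsE; exact: normc_ge_Re. Qed.

Lemma norm_ci : `|'i%C : R[i]| = 1.
Proof.
apply/eqP; rewrite -(@eqrXn2 _ 2)// ?normr_ge0// expr1n sqr_normc.
by apply/eqP; simpc.
Qed.

Lemma norm_realc (x : R) : `|x%:C| = `|x|%:C.
Proof.
rewrite normc_def /= (_ : _ + _ = x ^+ 2) ?sqrtr_sqr//.
by rewrite -[RHS]addr0; congr (_ + _); rewrite expr2 mulr0.
Qed.

Lemma cabs_Im (z : R[i]) : `|complex.Im z| <= cabs z.
Proof.
have -> : complex.Im z = - complex.Re (z * 'i%C) by rewrite ReiNIm opprK.
rewrite normrN (le_trans (cabs_Re _))// -lecR -!cabsE normrM.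
by rewrite norm_ci mulr1.
Qed.

Lemma cabs_le (z : R[i]) : cabs z <= `|complex.Re z| + `|complex.Im z|.
Proof.
rewrite -lecR -cabsE [z in `|z|]complexE (le_trans (ler_normD _ _))//.
by rewrite normrM norm_ci mul1r !norm_realc rmorphD.
Qed.

Lemma complex_complete (F : set_system R[i]^o) :
  ProperFilter F -> cauchy F -> cvg F.
Proof.
move=> FF /cauchy_ballP Fc.
pose re : R[i]^o -> R := @complex.Re R.
pose im : R[i]^o -> R := @complex.Im R.
have Rec : cauchy (re @ F).
  apply/cauchy_ballP => e e0.
  have := Fc e%:C; rewrite ltcR => /(_ e0)[[P Q] [/= FP FQ] PQ].
  exists (re @` P, re @` Q) => /=.
    by split; [apply: filterS FP|apply: filterS FQ] => z Pz /=; exists z.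
  move=> [_ _] /= [[z Pz <-] [w Qw <-]].
  have /= := PQ (z, w) (conj Pz Qw).
  rewrite -!ball_normE /= cabsE ltcR; apply: le_lt_trans.
  by rewrite -raddfB; exact: cabs_Re.
have Imc : cauchy (im @ F).
  apply/cauchy_ballP => e e0.
  have := Fc e%:C; rewrite ltcR => /(_ e0)[[P Q] [/= FP FQ] PQ].
  exists (im @` P, im @` Q) => /=.
    by split; [apply: filterS FP|apply: filterS FQ] => z Pz /=; exists z.
  move=> [_ _] /= [[z Pz <-] [w Qw <-]].
  have /= := PQ (z, w) (conj Pz Qw).
  rewrite -!ball_normE /= cabsE ltcR; apply: le_lt_trans.
  by rewrite -raddfB; exact: cabs_Im.
have /cvg_ex[/= a Fa] : cvg (re @ F) by exact: R_complete.
have /cvg_ex[/= b Fb] : cvg (im @ F) by exact: R_complete.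
apply/cvg_ex; exists (a +i* b); apply/cvgrPdist_lt => e e0.
have eE : e = (complex.Re e)%:C by rewrite RRe_real// gtr0_real.
move: e0; rewrite eE (ltcR 0) => e0; near=> z.
rewrite cabsE ltcR (le_lt_trans (cabs_le _))//.
rewrite [ltRHS](splitr (complex.Re e)) ltrD//.
  rewrite raddfB /=; near: z.
  by move/cvgrPdist_lt : Fa; apply; rewrite divr_gt0.
rewrite raddfB /=; near: z.
by move/cvgrPdist_lt : Fb; apply; rewrite divr_gt0.
Unshelve. all: by end_near. Qed.

End Complete.

Section BoundedFunctions.
Context {R : realType} {X : Type}.

Definition bounded_fun : {pred (X -> R[i])} :=
  fun f => `[< exists M : R, forall x, `|f x| <= M%:C >].

Record bfun := BFun { bfun_val :> X -> R[i]; _ : bfun_val \in bounded_fun }.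

HB.instance Definition _ := [isSub for bfun_val].
HB.instance Definition _ := [Choice of bfun by <:].

Lemma bfunP (f : bfun) : exists M : R, forall x, `|f x| <= M%:C.
Proof. by have /asboolP := valP f. Qed.

Lemma bounded_funP (f : X -> R[i]) :
  reflect (exists M : R, forall x, `|f x| <= M%:C) (f \in bounded_fun).
Proof. exact: asboolP. Qed.

Lemma bounded_fun_submod : GRing.subsemimod_closed bounded_fun.
Proof.
split; first split.
- by apply/bounded_funP; exists 0 => x; rewrite normr0.
- move=> f g /bounded_funP[M fM] /bounded_funP[N gN]; apply/bounded_funP.
  exists (M + N) => x; rewrite (le_trans (ler_normD _ _))// rmorphD /=.
  exact: lerD.
- move=> c f /bounded_funP[M fM]; apply/bounded_funP.
  exists (cabs c * M) => x; rewrite normrM rmorphM /= -cabsE.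
  exact: ler_wpM2l.
Qed.

HB.instance Definition _ :=
  GRing.SubChoice_isSubLmodule.Build R[i] (X -> R[i]) bounded_fun bfun
    bounded_fun_submod.

Lemma bounded_fun1 : (fun=> 1) \in bounded_fun.
Proof. by apply/bounded_funP; exists 1 => x; rewrite normr1. Qed.

Lemma bounded_funM (f g : bfun) : (fun x => f x * g x) \in bounded_fun.
Proof.
have [M fM] := bfunP f; have [N gN] := bfunP g.
apply/bounded_funP; exists (M * N) => x; rewrite normrM rmorphM /=.
exact: ler_pM.
Qed.

Lemma bounded_funJ (f : bfun) : (fun x => (f x)^*) \in bounded_fun.
Proof.
have [M fM] := bfunP f; apply/bounded_funP; exists M => x.
by rewrite normcJ.
Qed.

Definition bfun1 : bfun := BFun bounded_fun1.
Definition bfunM (f g : bfun) : bfun := BFun (bounded_funM f g).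
Definition bfunJ (f : bfun) : bfun := BFun (bounded_funJ f).

(* When X is empty, the supremum is that of set0, which is 0. *)
Definition bfun_norm (f : bfun) : R[i] := (sup (range (fun x => cabs (f x))))%:C.

Lemma bfunext (f g : bfun) : (forall x, f x = g x) -> f = g.
Proof. by move=> fg; apply/val_inj/funext. Qed.

Lemma bfunDE (f g : bfun) x : (f + g) x = f x + g x.
Proof. by []. Qed.

Lemma bfunNE (f : bfun) x : (- f) x = - f x.
Proof. by []. Qed.

Lemma bfunZE c (f : bfun) x : (c *: f) x = c * f x.
Proof. by []. Qed.

Lemma bfun_norm_ge (f : bfun) x : `|f x| <= bfun_norm f.
Proof.
rewrite cabsE lecR; apply: ub_le_sup; last by exists x.
have [M fM] := bfunP f; exists M => _ [y _ <-].
by rewrite -lecR -cabsE.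
Qed.

Lemma bfun_norm_ge0 (f : bfun) : 0 <= bfun_norm f.
Proof.
rewrite ler0c; have [[x _]|/set0P/negP/negPn/eqP X0] := pselect ([set: X] !=set0).
  by have := bfun_norm_ge f x; rewrite cabsE lecR; apply: le_trans; exact: cabs_ge0.
by rewrite X0 image_set0 sup0.
Qed.

Lemma bfun_norm_le (f : bfun) (M : R[i]) : 0 <= M ->
  (forall x, `|f x| <= M) -> bfun_norm f <= M.
Proof.
move=> M0 fM; have ME : M = (complex.Re M)%:C by rewrite RRe_real// ger0_real.
rewrite ME lecR.
have [[x _]|/set0P/negP/negPn/eqP X0] := pselect ([set: X] !=set0); last first.
  by rewrite X0 image_set0 sup0 -ler0c -ME.
apply: ge_sup; first by exists (cabs (f x)), x.
by move=> _ [y _ <-]; rewrite -lecR -cabsE -ME.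
Qed.

Lemma bfun_normD (f g : bfun) : bfun_norm (f + g) <= bfun_norm f + bfun_norm g.
Proof.
apply: bfun_norm_le => [|x]; first by rewrite addr_ge0 ?bfun_norm_ge0.
by rewrite (le_trans (ler_normD _ _))// lerD ?bfun_norm_ge.
Qed.

Lemma bfun_normZ c (f : bfun) : bfun_norm (c *: f) = `|c| * bfun_norm f.
Proof.
apply/eqP; rewrite eq_le; apply/andP; split.
  apply: bfun_norm_le => [|x]; first by rewrite mulr_ge0 ?bfun_norm_ge0.
  by rewrite bfunZE normrM ler_wpM2l ?bfun_norm_ge.
have [->|c0] := eqVneq c 0; first by rewrite normr0 mul0r bfun_norm_ge0.
rewrite -ler_pdivlMl ?normr_gt0//; apply: bfun_norm_le => [|x].
  by rewrite mulr_ge0 ?invr_ge0 ?bfun_norm_ge0.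
by rewrite ler_pdivlMl ?normr_gt0// -normrM -bfunZE bfun_norm_ge.
Qed.

Lemma bfun_norm0_eq0 (f : bfun) : bfun_norm f = 0 -> f = 0.
Proof.
move=> f0; apply: bfunext => x; apply/eqP; rewrite -normr_le0 -f0.
exact: bfun_norm_ge.
Qed.

HB.instance Definition _ := Lmodule_isNormed.Build R[i] bfun
  bfun_normD bfun_normZ bfun_norm0_eq0.

Lemma bfun_complete (F : set_system bfun) :
  ProperFilter F -> cauchy F -> cvg F.
Proof.
move=> FF /cauchy_ballP Fc.
pose ev x : bfun -> R[i]^o := fun f => f x.
have evc x : exists l : R[i]^o, ev x @ F --> l.
  apply/cvg_ex; apply: complex_complete; apply/cauchy_ballP => e /Fc [[P Q] [/= FP FQ] PQ].
  exists (ev x @` P, ev x @` Q) => /=.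
    by split; [apply: filterS FP|apply: filterS FQ] => f Pf /=; exists f.
  move=> [_ _] /= [[f Pf <-] [g Qg <-]].
  have /= := PQ (f, g) (conj Pf Qg).
  rewrite -!ball_normE /=; apply: le_lt_trans.
  exact: bfun_norm_ge (f - g) x.
have [l evl] := choice evc.
have unif (e : R[i]) : 0 < e ->
    F [set f : bfun | forall x, `|f x - l x| <= e].
  move=> e0; have e20 : 0 < e / 2 by rewrite divr_gt0.
  have [[P Q] [/= FP FQ] PQ] := Fc _ e20.
  apply: filterS FP => f Pf x.
  have Fl : \forall g \near F, `|l x - ev x g| < e / 2.
    by move/cvgrPdist_lt : (evl x); apply.
  have [g [/= Qg gl]] := filter_ex (filterI FQ Fl).
  have := PQ (f, g) (conj Pf Qg); rewrite -ball_normE /= => fg.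
  rewrite -(subrK (g x) (f x)) -addrA (le_trans (ler_normD _ _))//.
  rewrite [leRHS](splitr e) lerD//; last by rewrite distrC ltW.
  exact: le_trans (bfun_norm_ge (f - g) x) (ltW fg).
have lb : (l : X -> R[i]) \in bounded_fun.
  have [f fl] := filter_ex (unif 1 ltr01).
  have [M fM] := bfunP f; apply/bounded_funP; exists (1 + M) => x.
  rewrite -(subrK (f x) (l x)) (le_trans (ler_normD _ _))// rmorphD lerD//=.
  by rewrite distrC.
apply/cvg_ex; exists (BFun lb); apply/cvgrPdist_le => e e0.
have := unif e e0; apply: filterS => f fl.
by apply: bfun_norm_le (ltW e0) _ => x; rewrite -normrN opprB; exact: fl.
Qed.

HB.instance Definition _ := Uniform_isComplete.Build bfun bfun_complete.

Let bfunMA : associative bfunM.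
Proof. by move=> f g h; apply: bfunext => x; exact: mulrA. Qed.
Let bfunM1l : left_id bfun1 bfunM.
Proof. by move=> f; apply: bfunext => x; exact: mul1r. Qed.
Let bfunM1r : right_id bfun1 bfunM.
Proof. by move=> f; apply: bfunext => x; exact: mulr1. Qed.
Let bfunMDl : left_distributive bfunM +%R.
Proof. by move=> f g h; apply: bfunext => x; exact: mulrDl. Qed.
Let bfunMDr : right_distributive bfunM +%R.
Proof. by move=> f g h; apply: bfunext => x; exact: mulrDr. Qed.
Let bfunMZl (c : R[i]) (f g : bfun) : bfunM (c *: f) g = c *: bfunM f g.
Proof. by apply: bfunext => x; exact: esym (mulrA c (f x) (g x)). Qed.
Let bfunMZr (c : R[i]) (f g : bfun) : bfunM f (c *: g) = c *: bfunM f g.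
Proof. by apply: bfunext => x; exact: mulrCA. Qed.
Let bfunJD : {morph bfunJ : f g / f + g}.
Proof. by move=> f g; apply: bfunext => x; exact: rmorphD. Qed.
Let bfunJZ (c : R[i]) (f : bfun) : bfunJ (c *: f) = c^* *: bfunJ f.
Proof. by apply: bfunext => x; exact: rmorphM. Qed.
Let bfunJM (f g : bfun) : bfunJ (bfunM f g) = bfunM (bfunJ g) (bfunJ f).
Proof. by apply: bfunext => x /=; rewrite rmorphM mulrC. Qed.
Let bfunJK : involutive bfunJ.
Proof. by move=> f; apply: bfunext => x /=; rewrite conjcK. Qed.
Let bfun_normM (f g : bfun) : `|bfunM f g| <= `|f| * `|g|.
Proof.
apply: bfun_norm_le => [|x]; first by rewrite mulr_ge0.
by rewrite /= normrM ler_pM// bfun_norm_ge.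
Qed.
Let bfun_normJ (f : bfun) : `|bfunM (bfunJ f) f| = `|f| ^+ 2.
Proof.
apply/eqP; rewrite eq_le; apply/andP; split.
  apply: le_trans (bfun_normM _ _) _; rewrite expr2 ler_wpM2r//.
  apply: bfun_norm_le => // x /=; rewrite normcJ; exact: bfun_norm_ge.
set c := `|bfunM _ _|; have c0 : 0 <= c by exact: normr_ge0.
suff h : `|f| <= sqrtC c.
  apply: (@le_trans _ _ (sqrtC c ^+ 2)); last by rewrite sqrtCK.
  by rewrite !expr2; apply: ler_pM.
apply: bfun_norm_le => [|x]; first by rewrite sqrtC_ge0.
rewrite -(@ler_pXn2r _ 2)// ?nnegrE ?sqrtC_ge0// sqrtCK.
rewrite sqr_normc -[X in X <= _]ger0_norm ?mulcJ_ge0// mulrC.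
exact: bfun_norm_ge (bfunM (bfunJ f) f) x.
Qed.

HB.instance Definition _ := isCStarAlgebra.Build R bfun bfunMA bfunM1l bfunM1r
  bfunMDl bfunMDr bfunMZl bfunMZr bfunJD bfunJZ bfunJM bfunJK
  bfun_normM bfun_normJ.
HB.instance Definition _ :=
  GRing.PzRing.copy bfun (CStarAlgebra.sort (bfun : cStarAlgType R)).

End BoundedFunctions.
Arguments bfun R X : clear implicits.

Lemma contractive_continuous (R : realType) (A B : cStarAlgType R) (f : A -> B) :
  (forall (c : R[i]) x y, f (c *: x + y) = c *: f x + f y) ->
  (forall x, `|f x| <= `|x|) -> continuous f.
Proof.
move=> flin fle x; apply/cvgrPdist_lt => e e0.
apply: filterS (nbhsx_ballx x _ e0) => y; rewrite -ball_normE /=.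
apply: le_lt_trans.
have -> : f x - f y = f (x - y).
  by rewrite addrC -scaleN1r -flin scaleN1r addrC.
exact: fle.
Qed.

Record unitalSubalg (R : realType) (A : cStarAlgType R) := UnitalSubalg {
  usub_set :> set A;
  usub_cstar : cstar_subalg usub_set;
  usub_one : usub_set 1
}.

Section Subalgebra.
Context {R : realType} {A : cStarAlgType R} {V : unitalSubalg A}.

Record subalg := Subalg { subalg_val :> A; _ : subalg_val \in (V : set A) }.

HB.instance Definition _ := [isSub for subalg_val].
HB.instance Definition _ := [Choice of subalg by <:].

Lemma subalgP (x : subalg) : usub_set V x.
Proof. by have := valP x; rewrite inE. Qed.

Lemma subalg_submod : GRing.subsemimod_closed (mem (V : set A)).
Proof.
have [[V0 Vl _] _ _] := usub_cstar V; split; first split.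
- by rewrite inE.
- by move=> x y; rewrite !inE => Vx Vy; rewrite -[x]scale1r; exact: Vl.
- by move=> c x; rewrite !inE => Vx; rewrite -[_ *: _]addr0; exact: Vl.
Qed.

HB.instance Definition _ :=
  GRing.SubChoice_isSubLmodule.Build R[i] A (mem (V : set A)) subalg
    subalg_submod.

Definition subalg_norm (x : subalg) : R[i] := `|subalg_val x|.

Let subalg_normD x y : subalg_norm (x + y) <= subalg_norm x + subalg_norm y.
Proof. exact: ler_normD. Qed.
Let subalg_normZ c x : subalg_norm (c *: x) = `|c| * subalg_norm x.
Proof. exact: normrZ. Qed.
Let subalg_norm0 x : subalg_norm x = 0 -> x = 0.
Proof. by move=> /normr0_eq0 x0; exact: val_inj. Qed.

HB.instance Definition _ := Lmodule_isNormed.Build R[i] subalg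
  subalg_normD subalg_normZ subalg_norm0.

Lemma subalg_complete (F : set_system subalg) :
  ProperFilter F -> cauchy F -> cvg F.
Proof.
move=> FF /cauchy_ballP Fc.
have /cvg_ex[/= l Fl] : cvg (subalg_val @ F).
  apply: cauchy_cvg; apply/cauchy_ballP => e /Fc [[P Q] [/= FP FQ] PQ].
  exists (subalg_val @` P, subalg_val @` Q) => /=.
    by split; [apply: filterS FP|apply: filterS FQ] => f Pf /=; exists f.
  move=> [_ _] /= [[f Pf <-] [g Qg <-]].
  by have /= := PQ (f, g) (conj Pf Qg); rewrite -!ball_normE.
have Vl : usub_set V l.
  have [[_ _ Vc] _ _] := usub_cstar V.
  by apply: (closed_cvg _ Vc _ _ Fl); apply: nearW => x; exact: subalgP.
apply/cvg_ex; exists (Subalg (mem_set Vl)); apply/cvgrPdist_lt => e e0.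
by move/cvgrPdist_lt : Fl => /(_ e e0).
Qed.

HB.instance Definition _ := Uniform_isComplete.Build subalg subalg_complete.

Let mem1 : 1 \in (V : set A).
Proof. by rewrite inE; exact: usub_one. Qed.
Let memM (x y : subalg) : (x : A) * (y : A) \in (V : set A).
Proof.
by rewrite inE; have [_ VM _] := usub_cstar V; apply: VM; exact: subalgP.
Qed.
Let memJ (x : subalg) : star (x : A) \in (V : set A).
Proof.
by rewrite inE; have [_ _ VJ] := usub_cstar V; apply: VJ; exact: subalgP.
Qed.

Definition subalg1 : subalg := Subalg mem1.
Definition subalgM (x y : subalg) : subalg := Subalg (memM x y).
Definition subalgJ (x : subalg) : subalg := Subalg (memJ x).

Let sMA : associative subalgM.
Proof. by move=> x y z; apply: val_inj; exact: mulrA. Qed.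
Let sM1l : left_id subalg1 subalgM.
Proof. by move=> x; apply: val_inj; exact: mul1r. Qed.
Let sM1r : right_id subalg1 subalgM.
Proof. by move=> x; apply: val_inj; exact: mulr1. Qed.
Let sMDl : left_distributive subalgM +%R.
Proof. by move=> x y z; apply: val_inj; exact: mulrDl. Qed.
Let sMDr : right_distributive subalgM +%R.
Proof. by move=> x y z; apply: val_inj; exact: mulrDr. Qed.
Let sMZl (c : R[i]) x y : subalgM (c *: x) y = c *: subalgM x y.
Proof. by apply: val_inj; exact: cmulZl. Qed.
Let sMZr (c : R[i]) x y : subalgM x (c *: y) = c *: subalgM x y.
Proof. by apply: val_inj; exact: cmulZr. Qed.
Let sJD : {morph subalgJ : x y / x + y}.
Proof. by move=> x y; apply: val_inj; exact: starD. Qed.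
Let sJZ (c : R[i]) x : subalgJ (c *: x) = c^* *: subalgJ x.
Proof. by apply: val_inj; exact: starZ. Qed.
Let sJM x y : subalgJ (subalgM x y) = subalgM (subalgJ y) (subalgJ x).
Proof. by apply: val_inj; exact: cstarM. Qed.
Let sJK : involutive subalgJ.
Proof. by move=> x; apply: val_inj; exact: starK. Qed.
Let snM x y : `|subalgM x y| <= `|x| * `|y|.
Proof. exact: cmul_norm_le. Qed.
Let snJ x : `|subalgM (subalgJ x) x| = `|x| ^+ 2.
Proof. exact: cstar_norm. Qed.

HB.instance Definition _ := isCStarAlgebra.Build R subalg sMA sM1l sM1r
  sMDl sMDr sMZl sMZr sJD sJZ sJM sJK snM snJ.
HB.instance Definition _ :=
  GRing.PzRing.copy subalg (CStarAlgebra.sort (subalg : cStarAlgType R)).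

End Subalgebra.
Arguments subalg {R A} V.

Definition transfer_operator (R : realType) (D : cStarAlgType R)
    (alpha L : D -> D) : Prop :=
  [/\ continuous L,
      forall (c : R[i]) a b, L (c *: a + b) = c *: L a + L b,
      forall a, positive a -> positive (L a)
    & forall a b, L (alpha a * b) = a * L b].

Record exelSystem (R : realType) := ExelSystem {
  exel_alg :> cStarAlgType R;
  exel_alpha : exel_alg -> exel_alg;
  exel_transfer : exel_alg -> exel_alg;
  exel_alpha_hom : star_hom exel_alpha;
  exel_transferP : transfer_operator exel_alpha exel_transfer
}.

Section CrossedProduct.
Context {R : realType} (D : exelSystem R).
Local Notation alpha := (@exel_alpha R D).
Local Notation L := (@exel_transfer R D).

(* The unit of T is the unit of D: for the relations to bound S, the
   representation iota has to be unital. *)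
Definition toeplitz_relations (T : cStarAlgType R) (iota : D -> T) (S : T) :
    Prop :=
  [/\ star_hom iota, iota 1 = 1,
      forall a, S * iota a = iota (alpha a) * S
    & forall a, star S * iota a * S = iota (L a)].

(* (T, iota, S) is the universal unital C*-algebra generated by a copy of D and
   an element S subject to the relations: it is determined up to a unique
   isomorphism compatible with iota and S. *)
Definition is_toeplitz_algebra (T : cStarAlgType R) (iota : D -> T) (S : T) :
    Prop :=
  [/\ toeplitz_relations iota S,
      cstar_generated (range iota `|` [set S]) = setT
    & forall (B : cStarAlgType R) (rho : D -> B) (s : B),
        toeplitz_relations rho s ->
        exists phi : T -> B,
          [/\ star_hom phi, phi 1 = 1, forall a, phi (iota a) = rho a & phi S = s]].

Definition redundancy (T : cStarAlgType R) (iota : D -> T) (S : T)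
    (a : D) (k : T) : Prop :=
  closed_span [set x | exists b c, x = iota b * S * star S * iota c] k /\
  forall b, iota a * iota b * S = k * iota b * S.

Definition redundancy_ideal (T : cStarAlgType R) (iota : D -> T) (S : T) :
    set T :=
  ideal_generated [set x | exists a k,
    [/\ redundancy iota S a k,
        closed_span [set y | exists b c d, y = b * alpha c * d] a
      & x = iota a - k]].

(* Q is the quotient of the universal algebra by the redundancy ideal, given by
   a surjective star-homomorphism whose kernel is that ideal. *)
Definition is_crossed_product (Q : cStarAlgType R) : Prop :=
  exists (T : cStarAlgType R) (iota : D -> T) (S : T) (q : T -> Q),
    [/\ is_toeplitz_algebra iota S, star_hom q, range q = setT
      & forall x, q x = 0 <-> redundancy_ideal iota S x].

End CrossedProduct.

Definition fullShift (a : finType) : topologicalType :=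
  prod_topology (fun _ : nat => discrete_topology a).

Definition shift {a : finType} (x : fullShift a) : fullShift a :=
  fun i => x i.+1.

Record shiftSpace (a : finType) := ShiftSpace {
  shift_set :> set (fullShift a);
  shift_closed : closed shift_set;
  shift_stable : shift @` shift_set `<=` shift_set
}.

Section Shift.
Context {a : finType} (X : shiftSpace a).

Definition points : topologicalType := set_type (shift_set X).

Lemma shift_point (x : points) : shift (val x) \in shift_set X.
Proof.
by rewrite inE; apply: shift_stable; exists (val x) => //; exact: set_valP.
Qed.

Definition sigma (x : points) : points := SigSub (shift_point x).

Lemma preimage_finite (x : points) : finite_set (sigma @^-1` [set x]).
Proof.
pose hd (y : points) : a := val y 0%N.
have inj : {in sigma @^-1` [set x] &, injective hd}.
  move=> y z; rewrite !inE /= => yx zx yz; apply: val_inj.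
  apply/funext => -[|i] //.
  have : sigma y = sigma z by rewrite yx zx.
  by move=> /(congr1 val) /(congr1 (fun s => s i)).
rewrite -(eq_finite_set (inj_card_eq inj)).
exact: finite_finset.
Qed.
End Shift.

Section Operators.
Context {R : realType} {a : finType} (X : shiftSpace a).
Local Notation X' := (points X).
Implicit Types (f : X' -> R[i]).

Definition alpha_fun f : X' -> R[i] := f \o @sigma a X.

Definition transfer_fun f : X' -> R[i] := fun x =>
  if x \in range (@sigma a X) then
    (#|` fset_set (@sigma a X @^-1` [set x])|%:R)^-1 *
      \sum_(y \in @sigma a X @^-1` [set x]) f y
  else 0.

Lemma alpha_bounded (f : bfun R X') : alpha_fun f \in bounded_fun.
Proof.
by have [M fM] := bfunP f; apply/bounded_funP; exists M => x; exact: fM.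
Qed.

Lemma transfer_le f (M : R[i]) : 0 <= M -> (forall x, `|f x| <= M) ->
  forall x, `|transfer_fun f x| <= M.
Proof.
move=> M0 fM x; rewrite /transfer_fun; case: ifPn => [_|]; last by rewrite normr0.
rewrite fsbig_finite/=; last exact: preimage_finite.
set s := fset_set _.
rewrite normrM normfV normr_nat.
have [/eqP s0|s0] := boolP (#|` s| == 0)%N.
  by rewrite s0 invr0 mul0r.
rewrite ler_pdivrMl ?ltr0n ?lt0n//.
rewrite (le_trans (ler_norm_sum _ _ _))//.
rewrite (le_trans (ler_sum _ (fun y _ => fM y)))//.
by rewrite big_const_seq count_predT iter_addr addr0 mulr_natl.
Qed.

Lemma transfer_bounded (f : bfun R X') : transfer_fun f \in bounded_fun.
Proof.
have [M fM] := bfunP f; apply/bounded_funP; exists `|M|.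
apply: transfer_le => [|x]; first by rewrite ler0c.
by rewrite (le_trans (fM x))// lecR ler_norm.
Qed.

Definition bfun_alpha (f : bfun R X') : bfun R X' := BFun (alpha_bounded f).
Definition bfun_transfer (f : bfun R X') : bfun R X' := BFun (transfer_bounded f).

(* R[i]^o is R[i] with the topology of its norm; every continuous function on
   the compact space of points of X is bounded. *)
Definition continuous_functions : set (bfun R X') :=
  [set f | continuous (f : X' -> R[i]^o)].

Definition DX_set : set (bfun R X') :=
  smallest [set V | [/\ cstar_subalg V,
                        forall f : bfun R X', V f -> V (bfun_transfer f)
                      & forall f : bfun R X', V f -> V (bfun_alpha f)]]
    continuous_functions.

Lemma DX_closed : [/\ cstar_subalg DX_set,
  forall f : bfun R X', DX_set f -> DX_set (bfun_transfer f)
  & forall f : bfun R X', DX_set f -> DX_set (bfun_alpha f)].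
Proof.
split; [split; [split|..]|..].
- by move=> V [[[[]]]].
- move=> c f g Df Dg V VP; have [[[[_ Vl _] _ _] _ _] _] := VP.
  by apply: Vl; [exact: Df|exact: Dg].
- apply: closed_bigI => V [[[[_ _ Vc] _ _] _ _] _]; exact: Vc.
- move=> f g Df Dg V VP; have [[[_ VM _] _ _] _] := VP.
  by apply: VM; [exact: Df|exact: Dg].
- by move=> f Df V VP; have [[[_ _ VJ] _ _] _] := VP; apply: VJ; exact: Df.
- by move=> f Df V VP; have [[_ VL _] _] := VP; apply: VL; exact: Df.
- by move=> f Df V VP; have [[_ _ Va] _] := VP; apply: Va; exact: Df.
Qed.

Lemma DX_one : DX_set 1.
Proof. by move=> V [_]; apply; exact: cst_continuous. Qed.

Definition DX_subalg : unitalSubalg (bfun R X') :=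
  UnitalSubalg (let: And3 h _ _ := DX_closed in h) DX_one.

Definition DX : cStarAlgType R := subalg DX_subalg.

Let DX_mem (f : DX) : DX_set (subalg_val f) := subalgP f.

Lemma DX_alpha_mem (f : DX) : bfun_alpha (subalg_val f) \in DX_set.
Proof. by rewrite inE; have [_ _] := DX_closed; apply; exact: DX_mem. Qed.

Lemma DX_transfer_mem (f : DX) : bfun_transfer (subalg_val f) \in DX_set.
Proof. by rewrite inE; have [_ + _] := DX_closed; apply; exact: DX_mem. Qed.

Definition DX_alpha (f : DX) : DX := @Subalg _ _ DX_subalg _ (DX_alpha_mem f).
Definition DX_transfer (f : DX) : DX := @Subalg _ _ DX_subalg _ (DX_transfer_mem f).

Lemma DX_ext (f g : DX) :
  (forall x, subalg_val f x = subalg_val g x) -> f = g.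
Proof. by move=> fg; apply: (@val_inj _ _ (@subalg _ _ DX_subalg)); exact: bfunext. Qed.

Lemma DX_linE c (f g : DX) x :
  subalg_val (c *: f + g) x = c * subalg_val f x + subalg_val g x.
Proof. by []. Qed.

Lemma DX_mulE (f g : DX) x :
  subalg_val (f * g) x = subalg_val f x * subalg_val g x.
Proof. by []. Qed.

Lemma DX_starE (f : DX) x : subalg_val (star f) x = (subalg_val f x)^*.
Proof. by []. Qed.

Lemma DX_alphaE (f : DX) x : subalg_val (DX_alpha f) x = subalg_val f (sigma x).
Proof. by []. Qed.

Lemma DX_transferE (f : DX) x :
  subalg_val (DX_transfer f) x = transfer_fun (subalg_val f) x.
Proof. by []. Qed.

Lemma DX_alpha_hom : star_hom DX_alpha.
Proof.
split=> [c f g|f g|f]; apply: DX_ext => x.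
- by rewrite DX_linE !DX_alphaE DX_linE.
- by rewrite DX_mulE !DX_alphaE DX_mulE.
- by rewrite DX_starE !DX_alphaE DX_starE.
Qed.

Lemma transfer_funE f x : transfer_fun f x =
  (#|` fset_set (@sigma a X @^-1` [set x])|%:R)^-1 *
      \sum_(y <- fset_set (@sigma a X @^-1` [set x])) f y.
Proof.
rewrite /transfer_fun; case: ifPn => [_|xN].
  by rewrite fsbig_finite//; exact: preimage_finite.
suff -> : @sigma a X @^-1` [set x] = set0.
  by rewrite fset_set0 big_nil mulr0.
by apply/seteqP; split=> // y /= yx; move: xN; rewrite notin_setE; apply; exists y => //.
Qed.

Lemma DX_transfer_linear (c : R[i]) (f g : DX) :
  DX_transfer (c *: f + g) = c *: DX_transfer f + DX_transfer g.
Proof.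
apply: DX_ext => x; rewrite DX_linE !DX_transferE.
rewrite !transfer_funE mulrCA -mulrDr; congr (_ * _).
rewrite mulr_sumr -big_split.
by apply: eq_bigr => y _; rewrite DX_linE.
Qed.

Lemma DX_transfer_alpha (f g : DX) :
  DX_transfer (DX_alpha f * g) = f * DX_transfer g.
Proof.
apply: DX_ext => x; rewrite DX_mulE !DX_transferE.
rewrite !transfer_funE mulrCA; congr (_ * _); rewrite mulr_sumr.
apply: eq_big_seq => y; rewrite in_fset_set; last exact: preimage_finite.
by rewrite inE => yx; rewrite DX_mulE DX_alphaE (yx : sigma y = x).
Qed.

Lemma DX_transfer_norm (f : DX) : `|DX_transfer f| <= `|f|.
Proof.
apply: bfun_norm_le => // x; apply: transfer_le => // y.
exact: (bfun_norm_ge (subalg_val f)).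
Qed.

Lemma DX_transfer_continuous : continuous DX_transfer.
Proof.
exact: contractive_continuous DX_transfer_linear DX_transfer_norm.
Qed.

End Operators.

Section SquareRoot.
Variable R : realType.

Fixpoint newton (u : R) (n : nat) : R :=
  if n is m.+1 then newton u m + 2^-1 * (u - newton u m * newton u m) else 0.

Lemma newton_bound (s : R) n : 0 <= s -> s <= 1 ->
  [/\ 0 <= newton (s * s) n, newton (s * s) n <= s
    & (s - newton (s * s) n) * (1 + n%:R * (s / 2)) <= s].
Proof.
move=> s0 s1; elim: n => [|n [r0 rs rn]] /=.
  by rewrite mul0r addr0 mulr1 subr0.
set r := newton _ _ in r0 rs rn *.
have step : s - (r + 2^-1 * (s * s - r * r)) = (s - r) * (1 - (s + r) / 2).
  by field.
have f0 : 0 <= 1 - (s + r) / 2 by lra.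
have f1 : 1 - (s + r) / 2 <= 1 - s / 2 by lra.
have d0 : 0 <= s - r by lra.
split.
- by nra.
- by rewrite -subr_ge0 step mulr_ge0.
rewrite step -mulrA; apply: le_trans rn; apply: ler_wpM2l => //.
have k0 : 0 <= n%:R * (s / 2) :> R by rewrite mulr_ge0// divr_ge0.
have -> : n.+1%:R * (s / 2) = n%:R * (s / 2) + s / 2 by rewrite -natr1 mulrDl mul1r.
set k := n%:R * _ in k0 *.
apply: (@le_trans _ _ ((1 - s / 2) * (1 + (k + s / 2)))).
  by apply: ler_wpM2r => //; lra.
have : 0 <= s * k by exact: mulr_ge0.
nra.
Qed.

Lemma newton_cvg (s : R) n : 0 <= s -> s <= 1 ->
  n%:R * (s - newton (s * s) n) <= 2.
Proof.
move=> s0 s1; have [r0 rs rn] := newton_bound n s0 s1.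
move: s0; rewrite le_eqVlt => /predU1P[s0|s0].
  move: r0 rs; rewrite -s0 => r0 rs.
  have -> : newton (0 * 0) n = 0 by lra.
  by rewrite subr0 mulr0.
move: rn; set r := newton _ _ => rn; have d0 : 0 <= s - r by rewrite subr_ge0.
rewrite -(ler_pM2l s0).
by move: rn; set N : R := n%:R; nra.
Qed.

Lemma bfun_sqrt (X : Type) (V : set (bfun R X)) (g : bfun R X) :
  cstar_subalg V -> V g -> (forall x, 0 <= g x) ->
  exists2 h, V h & g = star h * h.
Proof.
move=> [[V0 Vl Vc] VM _] Vg g0.
pose M := 1 + `|g|; have M0 : 0 < M by rewrite ltr_pwDl.
pose u x := complex.Re (M^-1 * g x).
have uE x : (u x)%:C = M^-1 * g x.
  by rewrite RRe_real// ger0_real// mulr_ge0// invr_ge0 ltW.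
have u01 x : 0 <= u x <= 1.
  apply/andP; split; first by rewrite -ler0c uE mulr_ge0// invr_ge0 ltW.
  rewrite -lecR uE ler_pdivrMl// mulr1.
  apply: (@le_trans _ _ `|g|); last by rewrite lerDr.
  by rewrite -[X in X <= _]ger0_norm//; exact: bfun_norm_ge.
pose s x := Num.sqrt (u x).
have s0 x : 0 <= s x by exact: sqrtr_ge0.
have s1 x : s x <= 1.
  by rewrite -sqrtr1 ler_sqrt// ; have /andP[] := u01 x.
have ss x : s x * s x = u x by rewrite -expr2 sqr_sqrtr//; have /andP[] := u01 x.
have sb : (fun x => (s x)%:C) \in bounded_fun.
  by apply/bounded_funP; exists 1 => x; rewrite norm_realc lecR ger0_norm.
pose h : bfun R X := BFun sb.
pose g' : bfun R X := M^-1 *: g.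
pose P := fix P n : bfun R X :=
  if n is m.+1 then (2^-1)%:C *: (g' - P m * P m) + P m else 0.
have Vg' : V g' by rewrite -[g']addr0; exact: Vl.
have VP n : V (P n).
  elim: n => //= n IH; apply: (Vl) => //.
  by rewrite addrC -scaleN1r; apply: Vl => //; exact: VM.
have PE n x : P n x = (newton (u x) n)%:C.
  elim: n => //= n IH.
  rewrite [LHS](_ : _ = (2^-1)%:C * (M^-1 * g x - P n x * P n x) + P n x)//.
  by rewrite IH -uE -!(rmorphM, rmorphB, rmorphD)/= addrC.
have Vh : V h.
  apply: Vc => B /nbhs_ballP[e e0 eB].
  have eE : e = (complex.Re e)%:C by rewrite RRe_real// gtr0_real.
  have e0' : 0 < complex.Re e by rewrite -ltcR -eE.
  pose n := (Num.truncn (4 / complex.Re e)).+1.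
  exists (P n); split => //; apply: eB; rewrite -ball_normE /=.
  apply: (@le_lt_trans _ _ (complex.Re e / 2)%:C); last first.
    by rewrite [ltRHS]eE ltcR; lra.
  apply: bfun_norm_le => [|x]; first by rewrite ler0c; lra.
  rewrite [X in `|X|](_ : _ = (s x)%:C - P n x)// PE -rmorphB norm_realc lecR.
  rewrite -ss; have [_ rs _] := newton_bound n (s0 x) (s1 x).
  have := newton_cvg n (s0 x) (s1 x).
  rewrite ger0_norm ?subr_ge0// => nle.
  have ne : 4 / complex.Re e < n%:R by exact: truncnS_gt.
  move: ne; rewrite ltr_pdivrMr//.
  move: rs nle; move: (newton _ _) => r rs nle ne.
  move: e0' ne nle rs; move: (complex.Re e) (s x) (n%:R : R) => e1 s' N.
  nra.
exists (sqrtC M *: h); first by rewrite -[_ *: h]addr0; exact: Vl.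
have sM x : conjc (sqrtC M * (s x)%:C) = sqrtC M * (s x)%:C.
  apply: (@conj_Creal R[i]); rewrite ger0_real//.
  by rewrite mulr_ge0 ?ler0c// sqrtC_ge0 ltW.
apply: bfunext => x.
rewrite [RHS](_ : _ = conjc (sqrtC M * (s x)%:C) * (sqrtC M * (s x)%:C))//.
rewrite sM mulrACA -expr2 sqrtCK -rmorphM /= ss uE.
by rewrite mulrA divff ?mul1r// gt_eqF.
Qed.

End SquareRoot.

Section ShiftSystem.
Context {R : realType} {a : finType} (X : shiftSpace a).

Lemma DX_transfer_positive (f : @DX R a X) :
  positive f -> positive (DX_transfer f).
Proof.
move=> [b fb]; have [DV _ _] := @DX_closed R a X.
have L0 x : 0 <= subalg_val (DX_transfer f) x.
  rewrite DX_transferE transfer_funE mulr_ge0 ?invr_ge0 ?ler0n//.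
  rewrite big_seq sumr_ge0// => y _.
  by rewrite fb DX_mulE DX_starE mulrC mulcJ_ge0.
have [h Dh hE] := bfun_sqrt DV (subalgP (DX_transfer f)) L0.
exists (@Subalg _ _ (DX_subalg X) h (mem_set Dh)).
by apply: DX_ext => x; rewrite hE.
Qed.

Lemma DX_transfer_operator :
  @transfer_operator R (DX X) (@DX_alpha R a X) (@DX_transfer R a X).
Proof.
split; [exact: DX_transfer_continuous|exact: DX_transfer_linear|
        exact: DX_transfer_positive|exact: DX_transfer_alpha].
Qed.

Definition shift_system : exelSystem R :=
  ExelSystem (@DX_alpha_hom R a X) DX_transfer_operator.

End ShiftSystem.
Arguments shift_system R {a} X.

Section TopologicalMarkovShift.
Context {n : nat} (A : 'M[nat]_n).

(* The alphabet {1, ..., n} is 'I_n. *)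
Definition markov_set : set (fullShift 'I_n) :=
  [set x | forall i : nat, A (x i) (x i.+1) = 1%N].

Lemma markov_closed : closed markov_set.
Proof.
have -> : markov_set = \bigcap_(i in [set: nat])
    ~` (\bigcup_(p in [set p : 'I_n * 'I_n | A p.1 p.2 <> 1%N])
          ((fun x : fullShift 'I_n => x i) @^-1` [set p.1] `&`
           (fun x : fullShift 'I_n => x i.+1) @^-1` [set p.2])).
  apply/seteqP; split => x.
    by move=> xA i _ [[p q] /= pq [/= xp xq]]; apply: pq; rewrite -xp -xq.
  move=> xA i; apply: contrapT => xi; apply: (xA i I).
  by exists (x i, x i.+1).
apply: closed_bigI => i _; rewrite closedC; apply: bigcup_open => -[p q] _ /=.
have op (k : nat) (r : discrete_topology 'I_n) :
    open ((fun x : fullShift 'I_n => x k) @^-1` [set r]).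
  apply: open_comp; last exact: discrete_open.
  by move=> x _; exact: (@proj_continuous _ (fun=> discrete_topology 'I_n) k).
by apply: openI; exact: op.
Qed.

Lemma markov_stable : shift @` markov_set `<=` markov_set.
Proof. by move=> _ [x xA <-] i; exact: xA. Qed.

Definition markov_shift : shiftSpace 'I_n :=
  ShiftSpace markov_closed markov_stable.

End TopologicalMarkovShift.

(* Main.v *)
Require Import Defs.
From mathcomp Require Import all_boot all_order all_algebra.
From mathcomp Require Import finmap complex.
From mathcomp Require Import all_classical all_reals.
From mathcomp Require Import topology normedtype sequences.
From mathcomp Require Import ring.

Set Implicit Arguments.
Unset Strict Implicit.
Unset Printing Implicit Defensive.
Import Order.TTheory GRing.Theory Num.Theory.
Import numFieldNormedType.Exports.

Local Open Scope classical_set_scope.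
Local Open Scope ring_scope.

(* Put S_i = u_i S, where u_i(x) = [x_0 = i] sqrt(N(x_1)) and N(j) is the number
   of i with A(i,j) = 1. Then S_i^* S_j is a transfer, hence a function, while
   (1_[i], u_i S S^* u_i^* ) is a redundancy, so S_i S_i^* = 1_[i] in the
   crossed product; the Cuntz-Krieger relations and generation follow.

   Conversely, a Cuntz-Krieger family T in B gives F -> sum_i T_i F(i.) T_i^*,
   which iterated m times represents functions on the full shift by their
   values on words of length m. Composed with a retraction of the full shift
   onto X_A these maps are *-homomorphisms rho_m on D_X, hence contractive, and
   rho_m f is eventually constant when f depends on finitely many letters, so
   that rho = lim rho_m exists. With s = (sum_i T_i) rho(N^(-1/2)) the pair
   (rho, s) satisfies the Toeplitz relations and T_i = rho(u_i) s. A redundancy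
   (a, k) yields (rho(a) - k) T_i = 0 for all i, so rho(a) = k because
   sum_i T_i T_i^* = 1. *)

(** * Elementary facts on C*-algebras *)

Section ComplexNormed.
Context {R : realType}.

Lemma gt0_complexE (e : R[i]) : 0 < e -> exists2 d : R, 0 < d & e = d%:C%C.
Proof.
move=> e0; have eE : e = (complex.Re e)%:C%C by rewrite RRe_real// gtr0_real.
by exists (complex.Re e) => //; rewrite -ltcR -eE.
Qed.

Lemma ge0_complexE (e : R[i]) : 0 <= e -> exists2 d : R, 0 <= d & e = d%:C%C.
Proof.
move=> e0; have eE : e = (complex.Re e)%:C%C by rewrite RRe_real// ger0_real.
by exists (complex.Re e) => //; rewrite -lecR -eE.
Qed.

Lemma cauchy_seq_cvg (V : completeNormedModType R[i]) (u : nat -> V) :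
  (forall e : R[i], 0 < e ->
    exists N, forall n, (N <= n)%N -> `|u N - u n| < e) ->
  cvg (u @ \oo).
Proof.
move=> uc; apply: cauchy_cvg; apply: cauchy_exP => e e0.
have [N uN] := uc e e0; exists (u N); exists N => // n /= Nn.
by rewrite -ball_normE /=; exact: uN.
Qed.

Lemma geometric_steps_cvg (V : completeNormedModType R[i]) (u : nat -> V) (t : R) :
  0 <= t -> t < 1 ->
  (forall n, `|u n.+1 - u n| <= (t ^+ n)%:C%C) -> cvg (u @ \oo).
Proof.
move=> t0 t1 ut; apply: cauchy_seq_cvg => _ /gt0_complexE[d d0 ->].
have t1' : 0 < 1 - t by rewrite subr_gt0.
have far N m : `|u N - u (N + m)%N| <= (t ^+ N * (1 - t ^+ m) / (1 - t))%:C%C.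
  elim: m => [|m IH]; first by rewrite addn0 subrr normr0 expr0 subrr mulr0 mul0r.
  rewrite addnS -(subrK (u (N + m)%N) (u N)) -addrA.
  rewrite (le_trans (ler_normD _ _))//.
  have -> : t ^+ N * (1 - t ^+ m.+1) / (1 - t) =
      t ^+ N * (1 - t ^+ m) / (1 - t) + t ^+ (N + m).
    by rewrite exprD exprS; field; rewrite gt_eqF.
  by rewrite rmorphD lerD// distrC.
have [N _ tN] : \forall N \near \oo, t ^+ N < d * (1 - t).
  have /cvgrPdist_lt/(_ (d * (1 - t))) : t ^+ n @[n --> \oo] --> 0.
    by apply: cvg_expr; rewrite ger0_norm.
  rewrite mulr_gt0// => /(_ isT); apply: filterS => n.
  by rewrite sub0r normrN ger0_norm// exprn_ge0.
exists N => n Nn; rewrite -(subnKC Nn) (le_lt_trans (far _ _))// ltcR.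
rewrite ltr_pdivrMr//; apply: le_lt_trans (tN N _) => //=.
by rewrite ler_piMr ?exprn_ge0// gerBl exprn_ge0.
Qed.

End ComplexNormed.

Section CStarBasics.
Context {R : realType} {A : cStarAlgType R}.
Implicit Types (c : R[i]) (x y z e p : A).

Lemma starB x y : star (x - y) = star x - star y.
Proof. by rewrite -scaleN1r starD starZ rmorphN1 scaleN1r. Qed.

Lemma star0 : star (0 : A) = 0.
Proof. by rewrite -[0 in LHS](subrr (0 : A)) starB subrr. Qed.

Lemma star1 : star (1 : A) = 1.
Proof. by rewrite -[LHS]mulr1 -[X in _ * X]starK -starM mulr1 starK. Qed.

Lemma star_sum (I : Type) (r : seq I) (P : pred I) (F : I -> A) :
  star (\sum_(i <- r | P i) F i) = \sum_(i <- r | P i) star (F i).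
Proof. by apply: (big_morph (@star R A)) => [x y|]; [exact: starD|exact: star0]. Qed.

(** The C*-identity gives |y|^2 <= |star y| |y|; dividing by |y|, for [x] and for [star x], gives
    equality. *)
Lemma norm_star x : `|star x| = `|x|.
Proof.
have h y : `|y| <= `|star y|.
  have [->|y0] := eqVneq y 0; first by rewrite normr0.
  have ny : 0 < `|y| by rewrite normr_gt0.
  by rewrite -(ler_pM2r ny) -expr2 -norm_star_mul norm_mul_le.
by apply/eqP; rewrite eq_le -{1}[x in leRHS]starK !h.
Qed.

Lemma norm_selfadjoint_sq x : star x = x -> `|x * x| = `|x| ^+ 2.
Proof. by move=> {1}<-; exact: norm_star_mul. Qed.

Lemma star_mul_eq0 x : star x * x = 0 -> x = 0.
Proof.
move=> x0; apply/normr0_eq0/eqP; rewrite -sqrf_eq0 -norm_star_mul x0.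
by rewrite normr0.
Qed.

Lemma projection_norm_le1 p : projection p -> `|p| <= 1.
Proof.
move=> [ps pp]; have [->|p0] := eqVneq `|p| 0; first exact: ler01.
have p1 : 0 < `|p| by rewrite lt0r p0 normr_ge0.
by rewrite -(ler_pM2r p1) mul1r -expr2 -norm_selfadjoint_sq// pp.
Qed.

Lemma cvg_cmul (T : Type) (F : set_system T) (FF : ProperFilter F)
    (u v : T -> A) x y :
  u @ F --> x -> v @ F --> y -> (fun t => u t * v t) @ F --> x * y.
Proof.
move=> ux vy; apply/cvgrPdist_lt => e e0.
pose M := `|x| + `|y| + 1.
have M0 : 0 < M by rewrite ltr_wpDl// addr_ge0.
(* The bound d <= 1 keeps [v t] in the ball of radius |y| + 1; d <= e / (2 M) then controls both
   error terms at once. *)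
have [d d0 [d1 de]] : exists2 d : R[i], 0 < d & d <= 1 /\ d <= e / 2 / M.
  have [q q0 ->] : exists2 q : R, 0 < q & e / 2 / M = q%:C%C.
    by apply: gt0_complexE; rewrite !divr_gt0.
  exists (Num.min 1 q)%:C%C; first by rewrite ltcR lt_min ltr01.
  by rewrite !lecR !ge_min !lexx orbT.
near=> t.
have xu : `|x - u t| < d by near: t; move/cvgrPdist_lt : ux; apply.
have yv : `|y - v t| < d by near: t; move/cvgrPdist_lt : vy; apply.
have -> : x * y - u t * v t = (x - u t) * v t + x * (y - v t).
  by rewrite mulrBl mulrBr [RHS]addrC addrA subrK.
have vn : `|v t| <= `|y| + 1.
  rewrite -[v t](subrK y) addrC (le_trans (ler_normD _ _))// lerD//.
  by rewrite distrC (le_trans (ltW yv)).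
rewrite (le_lt_trans (ler_normD _ _))//.
have b1 : `|(x - u t) * v t| <= d * (`|y| + 1).
  by rewrite (le_trans (norm_mul_le _ _))// ler_pM// ltW.
have b2 : `|x * (y - v t)| <= `|x| * d.
  by rewrite (le_trans (norm_mul_le _ _))// ler_wpM2l// ltW.
apply: le_lt_trans (lerD b1 b2) _.
have -> : d * (`|y| + 1) + `|x| * d = d * M by rewrite /M; ring.
apply: (@le_lt_trans _ _ (e / 2)); first by rewrite -ler_pdivlMr.
by rewrite ltr_pdivrMr// ltr_pMr// ltr1n.
Unshelve. all: by end_near. Qed.

Lemma cvg_star (T : Type) (F : set_system T) (FF : ProperFilter F)
    (u : T -> A) x :
  u @ F --> x -> (fun t => star (u t)) @ F --> star x.
Proof.
move=> ux; apply/cvgrPdist_lt => e e0.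
move/cvgrPdist_lt : ux => /(_ e e0); apply: filterS => t.
by rewrite -starB norm_star.
Qed.

End CStarBasics.

(** * Square roots of 1 - y *)

Section SquareRootOneMinus.
Context {R : realType} {A : cStarAlgType R}.
Implicit Types (c : R[i]) (x y z e p : A).

Fixpoint sqrt_iter y n : A :=
  if n is m.+1 then 2^-1 *: (y + sqrt_iter y m * sqrt_iter y m) else 0.

Lemma half_conj : Num.conj (2^-1 : R[i]) = 2^-1.
Proof. by apply: (@conj_Creal R[i]); rewrite realV realn. Qed.

Lemma sqrt_iter_star y n : star y = y -> star (sqrt_iter y n) = sqrt_iter y n.
Proof.
move=> ys; elim: n => [|n IH] /=; first exact: star0.
by rewrite starZ half_conj starD starM IH ys.
Qed.

Lemma sqrt_iter_comm y z n : z * y = y * z ->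
  z * sqrt_iter y n = sqrt_iter y n * z.
Proof.
move=> zy; elim: n => [|n IH] /=; first by rewrite mul0r mulr0.
by rewrite csclAl csclAr mulrDl mulrDr zy mulrA IH -!mulrA IH.
Qed.

Lemma sqrt_iter_le y (t : R) n : `|y| = t%:C%C -> t < 1 ->
  `|sqrt_iter y n| <= t%:C%C.
Proof.
move=> yt t1; have t0 : 0 <= t by rewrite -lecR -yt normr_ge0.
elim: n => [|n IH] /=; first by rewrite normr0 lecR.
rewrite normrZ ger0_norm ?invr_ge0// ler_pdivrMl//.
rewrite (le_trans (ler_normD _ _))// mulr_natl mulr2n lerD ?yt//.
rewrite (le_trans (norm_mul_le _ _))//.
apply: (@le_trans _ _ (t%:C%C * t%:C%C)); first exact: ler_pM.
by rewrite -rmorphM lecR ler_piMr// ltW.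
Qed.

(** Since u^2 - v^2 = u (u - v) + (u - v) v and both iterates have norm at most t, the halved
    difference shrinks by the factor t at each step. *)
Lemma sqrt_iter_step y (t : R) n : `|y| = t%:C%C -> t < 1 ->
  `|sqrt_iter y n.+1 - sqrt_iter y n| <= (t ^+ n)%:C%C.
Proof.
move=> yt t1; have t0 : 0 <= t by rewrite -lecR -yt normr_ge0.
elim: n => [|n IH].
  rewrite [sqrt_iter y 0]/= subr0 (le_trans (sqrt_iter_le 1 yt t1))// lecR.
  by rewrite expr0 ltW.
rewrite [in X in X - _]/= -/(sqrt_iter y n.+1) [in X in _ - X]/=.
set u := sqrt_iter y n.+1 in IH *; set v := sqrt_iter y n in IH *.
have -> : 2^-1 *: (y + u * u) - 2^-1 *: (y + v * v) =
    2^-1 *: (u * (u - v) + (u - v) * v).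
  rewrite -scalerBr; congr (_ *: _); rewrite mulrBr mulrBl.
  by rewrite opprD addrACA subrr add0r addrA subrK.
have uv w : `|w| <= t%:C%C ->
    `|w| * `|u - v| <= (t ^+ n.+1)%:C%C.
  by move=> wt; rewrite exprS rmorphM; apply: ler_pM.
rewrite normrZ ger0_norm ?invr_ge0// ler_pdivrMl//.
rewrite (le_trans (ler_normD _ _))// mulr_natl mulr2n lerD//.
  by rewrite (le_trans (norm_mul_le _ _))// uv// sqrt_iter_le.
by rewrite (le_trans (norm_mul_le _ _))// mulrC uv// sqrt_iter_le.
Qed.

(* Writing h = 1 - k, the equation h^2 = 1 - y becomes k = (y + k^2) / 2, a
   contraction of the ball of radius |y|. *)
Lemma sqrt_one_minus y : star y = y -> `|y| < 1 ->
  exists h, [/\ star h = h, h * h = 1 - y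
              & forall z, z * y = y * z -> z * h = h * z].
Proof.
move=> ys y1; have [t t0 yt] := ge0_complexE (normr_ge0 y).
have t1 : t < 1 by rewrite -ltcR -yt.
have /cvg_ex[/= k kl] : cvg (sqrt_iter y @ \oo).
  by apply: (geometric_steps_cvg t0 t1) => n; exact: sqrt_iter_step.
have ks : star k = k.
  apply: (norm_cvg_unique _ kl).
  rewrite (_ : sqrt_iter y = fun n => star (sqrt_iter y n)); last first.
    by apply/funext => n; rewrite sqrt_iter_star.
  exact: cvg_star.
have kk : k = 2^-1 *: (y + k * k).
  have kl' : sqrt_iter y n.+1 @[n --> \oo] --> k by rewrite cvg_shiftS.
  apply: (norm_cvg_unique kl').
  by apply: cvgZl_tmp; apply: cvgD; [exact: cvg_cst|exact: cvg_cmul].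
have kc z : z * y = y * z -> z * k = k * z.
  move=> zy; apply: (@norm_cvg_unique _ _ ((fun n => z * sqrt_iter y n) @ \oo)).
    exact: cvg_cmul (cvg_cst _) kl.
  rewrite (_ : (fun n => _) = fun n => sqrt_iter y n * z); last first.
    by apply/funext => n; exact: sqrt_iter_comm.
  exact: cvg_cmul kl (cvg_cst _).
exists (1 - k); split=> [||z zy].
- by rewrite starB star1 ks.
- have kE : k + k = y + k * k.
    rewrite [in LHS]kk -scalerDl -[X in X *: _](_ : 1 = _) ?scale1r//.
    by field.
  have -> : y = k + k - k * k by rewrite kE addrK.
  rewrite mulrBl mul1r mulrBr mulr1 !opprB opprD -!addrA; congr (_ + _).
  exact: addrCA.
- by rewrite mulrBl mulrBr mul1r mulr1 kc.
Qed.

End SquareRootOneMinus.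

(** * Contractivity of *-homomorphisms and orthogonality of projections *)

Section SumOfSquares.
Context {R : realType} {A : cStarAlgType R}.
Implicit Types (c : R[i]) (x y z h e p : A).

(* scalerA, restated because its scalar structure is not inferred on A. *)
Lemma csclA (a b : R[i]) x : a *: (b *: x) = (a * b) *: x.
Proof. exact: scalerA. Qed.

Lemma scale_half_double x : 2^-1 *: (x + x) = x.
Proof.
rewrite -[X in X + X](scale1r x) -scalerDl csclA -[1 + 1]/(2%:R).
by rewrite mulVf ?scale1r// pnatr_eq0.
Qed.

(** For u = x + i h and for u = x - i h, commutation makes [star u * u] equal to x^2 + h^2, so both
    have the same norm by the C*-identity; x is their mean. No spectral theory enters. *)
Lemma normsq_le_sum_squares x h : star x = x -> star h = h -> x * h = h * x ->
  `|x| ^+ 2 <= `|x * x + h * h|.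
Proof.
move=> xs hs xh.
have uu (c : R[i]) : Num.conj c = - c -> c * c = -1 ->
    star (x + c *: h) * (x + c *: h) = x * x + h * h.
  move=> cc c2; rewrite starD starZ xs hs cc mulrDl !mulrDr.
  rewrite !csclAl !csclAr.
  rewrite [- c *: (c *: _)]csclA mulNr c2 opprK scale1r xh addrA; congr (_ + _).
  by rewrite scaleNr addrK.
have ci : Num.conj ('i%C : R[i]) = - 'i%C by rewrite [LHS]/=; simpc.
have i2 : 'i%C * 'i%C = -1 :> R[i] by rewrite -expr2 sqr_i.
have n1 := norm_star_mul (x + 'i%C *: h).
have n2 := norm_star_mul (x + (- 'i%C) *: h).
have ci' : Num.conj (- 'i%C : R[i]) = - - 'i%C.
  by rewrite rmorphN; congr (- _); exact: ci.
rewrite uu// in n1; rewrite uu ?mulrNN// in n2.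
have nn : `|x + 'i%C *: h| = `|x + (- 'i%C) *: h|.
  by apply/eqP; rewrite -(@eqrXn2 _ 2)// -n1 -n2.
rewrite n1 ler_pXn2r// ?nnegrE//.
have xE : x = 2^-1 *: ((x + 'i%C *: h) + (x + (- 'i%C) *: h)).
  by rewrite addrACA -scalerDl subrr scale0r addr0 scale_half_double.
rewrite [x in leLHS]xE normrZ ger0_norm ?invr_ge0// ler_pdivrMl//.
by rewrite (le_trans (ler_normD _ _))// -nn mulr_natl mulr2n.
Qed.

End SumOfSquares.

Section StarHomTheory.
Context {R : realType} {A B : cStarAlgType R} (f : A -> B).
Hypothesis fhom : star_hom f.

Lemma star_homD x y : f (x + y) = f x + f y.
Proof. by have [fl _ _] := fhom; rewrite -[x]scale1r fl !scale1r. Qed.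

Lemma star_hom0 : f 0 = 0.
Proof. by apply: (addrI (f 0)); rewrite -star_homD !addr0. Qed.

Lemma star_homZ c x : f (c *: x) = c *: f x.
Proof. by have [fl _ _] := fhom; rewrite -[_ *: x]addr0 fl star_hom0 addr0. Qed.

Lemma star_homB x y : f (x - y) = f x - f y.
Proof. by rewrite -scaleN1r star_homD star_homZ scaleN1r. Qed.

Lemma star_homM x y : f (x * y) = f x * f y.
Proof. by have [_ fM _] := fhom; exact: fM. Qed.

Lemma star_homJ x : f (star x) = star (f x).
Proof. by have [_ _ fJ] := fhom; exact: fJ. Qed.

Lemma star_hom_sum (I : Type) (r : seq I) (P : pred I) (F : I -> A) :
  f (\sum_(i <- r | P i) F i) = \sum_(i <- r | P i) f (F i).
Proof. by apply: (big_morph f) => [x y|]; [exact: star_homD|exact: star_hom0]. Qed.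

Let norm_le1 x : star x = x -> `|x| < 1 -> `|f x| <= 1.
Proof.
move=> xs x1.
have x2s : star (x * x) = x * x by rewrite starM xs.
have x2n : `|x * x| < 1 by rewrite norm_selfadjoint_sq// expr_lt1.
have [h [hs h2 hc]] := sqrt_one_minus x2s x2n.
have xh : x * h = h * x by apply: hc; rewrite mulrA.
(* The sum is f(x^2 + h^2) = f(1), a projection but perhaps not 1, as [f] may fail to be unital. *)
have e1 : `|f x * f x + f h * f h| <= 1.
  rewrite -!star_homM h2 -star_homD addrC subrK; apply: projection_norm_le1.
  by split; rewrite -?star_homJ ?star1// -star_homM mulr1.
have := normsq_le_sum_squares (x := f x) (h := f h).
rewrite -!star_homJ xs hs -!star_homM xh !star_homM => /(_ erefl erefl erefl).
by move=> /le_trans/(_ e1); rewrite expr_le1.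
Qed.

(* A self-adjoint x of norm < 1 is the real part of a unitary x + i h, and
   *-homomorphisms map unitaries into the unit ball. *)
Lemma star_hom_contractive x : `|f x| <= `|x|.
Proof.
have sa y : star y = y -> `|f y| <= `|y|.
  move=> ys; apply/ler_addgt0Pr => e e0.
  (* Dividing by |y| + e instead of |y| brings the norm strictly below 1 and covers y = 0. *)
  have c0 : 0 < `|y| + e by rewrite ltr_wpDl.
  have cr : Num.conj ((`|y| + e)^-1) = (`|y| + e)^-1.
    by apply: (@conj_Creal R[i]); rewrite realV gtr0_real.
  have := @norm_le1 ((`|y| + e)^-1 *: y).
  rewrite starZ ys cr star_homZ !normrZ gtr0_norm ?invr_gt0//.
  rewrite ltr_pdivrMl// ler_pdivrMl// !mulr1 ltrDl => -> //.
rewrite -(@ler_pXn2r _ 2)// ?nnegrE// -!norm_star_mul -star_homJ -star_homM.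
by apply: sa; rewrite starM starK.
Qed.

Lemma star_hom_continuous : continuous f.
Proof.
have [fl _ _] := fhom.
exact: contractive_continuous fl star_hom_contractive.
Qed.

Lemma star_hom_preimage_subspace (V : set B) :
  closed_subspace V -> closed_subspace (f @^-1` V).
Proof.
move=> [V0 Vl Vc]; split=> [|c x y /= Vx Vy|].
- by rewrite /= star_hom0.
- by rewrite star_homD star_homZ; exact: Vl.
- by apply: closed_comp => // x _; exact: star_hom_continuous.
Qed.

Lemma star_hom_preimage_subalg (V : set B) :
  cstar_subalg V -> cstar_subalg (f @^-1` V).
Proof.
move=> [Vs VM VJ]; split=> [|x y /= Vx Vy|x /= Vx].
- exact: star_hom_preimage_subspace.
- by rewrite star_homM; exact: VM.
- by rewrite star_homJ; exact: VJ.
Qed.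

Lemma closed_zero_subspace : closed_subspace [set 0 : B].
Proof.
split=> //= [c x y -> ->|]; first by rewrite scaler0 addr0.
exact/accessible_closed_set1/hausdorff_accessible/norm_hausdorff.
Qed.

Lemma star_hom_kernel_ideal : closed_ideal [set x | f x = 0].
Proof.
split; first exact: star_hom_preimage_subspace closed_zero_subspace.
by move=> a x /= fx; rewrite !star_homM fx mul0r mulr0.
Qed.

End StarHomTheory.

Section OrthogonalProjections.
Context {R : realType} {A : cStarAlgType R}.
Implicit Types (c : R[i]) (x y z h e p : A).

(* For r < 1 write 1 - r^2 (e + z^2) = h^2 with h commuting with e and z; then
   z^2 + (h e / r)^2 = (1 / r^2 - 1) e, which is arbitrarily small. *)
Lemma corner_sq_eq0 e z : projection e -> star z = z -> e * z = z -> z * e = z ->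
  `|e + z * z| <= 1 -> z = 0.
Proof.
move=> [es ee] zs ez ze w1.
suff small (r : R) : 0 < r -> r < 1 -> `|z| ^+ 2 <= (1 / r - 1)%:C%C.
  apply/normr0_eq0/eqP; rewrite -sqrf_eq0 eq_le exprn_ge0 ?andbT//.
  apply/ler_addgt0Pr => _ /gt0_complexE[d d0 ->]; rewrite add0r.
  have d1 : 0 < 1 + d by rewrite addr_gt0.
  apply: le_trans (small (1 + d)^-1 _ _) _.
  - by rewrite invr_gt0.
  - by rewrite invf_lt1// ltrDl.
  - by rewrite lecR div1r invrK addrAC subrr add0r.
move=> r0 r1; set w := e + z * z in w1.
have ws : star w = w by rewrite starD starM zs es.
have rs : Num.conj r%:C%C = r%:C%C.
  by apply: (@conj_Creal R[i]); rewrite gtr0_real// ltcR.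
have ys : star (r%:C%C *: w) = r%:C%C *: w by rewrite starZ ws rs.
have yn : `|r%:C%C *: w| < 1.
  rewrite normrZ gtr0_norm ?ltcR//.
  by rewrite (le_lt_trans (ler_wpM2l _ w1)) ?lecR ?ltW// mulr1 ltcR.
have [h [hs h2 hc]] := sqrt_one_minus ys yn.
have eh : e * h = h * e.
  by apply: hc; rewrite csclAr csclAl mulrDr mulrDl mulrA ez -mulrA ze.
have zh : z * h = h * z.
  by apply: hc; rewrite csclAr csclAl mulrDr mulrDl ez ze mulrA.
(* As h^2 = 1 - r (e + z^2), the factor in front of [h * e] must square to 1 / r for z^2 + g^2 to be
   (1 / r - 1) e. *)
pose s := Num.sqrt r^-1.
have s2 : s%:C%C * s%:C%C = (r^-1)%:C%C :> R[i].
  by rewrite -rmorphM /= -expr2 sqr_sqrtr// invr_ge0 ltW.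
have ss : Num.conj s%:C%C = s%:C%C.
  by apply: (@conj_Creal R[i]); rewrite ger0_real// lecR sqrtr_ge0.
pose g := s%:C%C *: (h * e).
have gs : star g = g by rewrite starZ starM hs es eh ss.
have zg : z * g = g * z.
  by rewrite csclAr csclAl mulrA zh -!mulrA ez ze.
have gg : z * z + g * g = (1 / r - 1)%:C%C *: e.
  rewrite csclAr csclAl csclA s2 mulrA -(mulrA h) eh mulrA -mulrA ee h2.
  rewrite mulrBl mul1r csclAl mulrDl ee -mulrA ze scalerBr csclA.
  rewrite -rmorphM /= mulVf ?gt_eqF// scale1r opprD [- e - _]addrC.
  by rewrite addrCA addNKr mul1r rmorphB /= scalerBl scale1r.
apply: le_trans (normsq_le_sum_squares zs gs zg) _.
have rr : 0 <= 1 / r - 1 by rewrite subr_ge0 div1r ltW// invf_gt1.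
rewrite gg normrZ ger0_norm ?lecR// ler_piMr ?lecR//.
exact: projection_norm_le1.
Qed.

(** For x = z / M both e + x and e - x lie in the unit ball, hence so does the mean of their
    squares, which is e + x^2; [corner_sq_eq0] applies to x. *)
Lemma corner_opp_bounded_eq0 e z (M : R[i]) : projection e -> star z = z ->
  e * z = z -> z * e = z -> 0 < M ->
  `|M *: e + z| <= M -> `|M *: e - z| <= M -> z = 0.
Proof.
move=> ep zs ez ze M0 h1 h2; have [es ee] := ep.
have Mu : M != 0 by rewrite gt_eqF.
suff : M^-1 *: z = 0.
  by move=> /(congr1 ( *:%R M)); rewrite csclA mulfV// scale1r scaler0.
have Ms : Num.conj (M^-1) = M^-1.
  by apply: (@conj_Creal R[i]); rewrite realV gtr0_real.
apply: (@corner_sq_eq0 e) => //.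
- by rewrite starZ zs Ms.
- by rewrite csclAr ez.
- by rewrite csclAl ze.
set x := M^-1 *: z.
have ex : e * x = x by rewrite csclAr ez.
have xe : x * e = x by rewrite csclAl ze.
have b (y : A) : `|M *: e + y| <= M -> `|e + M^-1 *: y| <= 1.
  have eE : e = M^-1 *: (M *: e) by rewrite csclA mulVf// scale1r.
  move=> yM; rewrite {1}eE -scalerDr normrZ.
  by rewrite gtr0_norm ?invr_gt0// ler_pdivrMl// mulr1.
have b1 : `|e + x| <= 1 by exact: b.
have b2 : `|e - x| <= 1 by rewrite -scalerN; exact: b.
have -> : e + x * x = 2^-1 *: ((e + x) * (e + x) + (e - x) * (e - x)).
  rewrite mulrDl mulrBl !mulrDr !mulrN ee ex xe opprB addrACA.
  have -> : e + x + (e - x) = e + e by rewrite addrACA subrr addr0.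
  have -> : x + x * x + (x * x - x) = x * x + x * x.
    by rewrite addrC -addrA [- x + _]addrA addNr add0r.
  by rewrite addrACA scale_half_double.
rewrite normrZ ger0_norm ?invr_ge0// ler_pdivrMl// mulr1.
rewrite (le_trans (ler_normD _ _))// mulr2n lerD//.
  by rewrite (le_trans (norm_mul_le _ _))// mulr_ile1.
by rewrite (le_trans (norm_mul_le _ _))// mulr_ile1.
Qed.

(* The x_i = p_j p_i p_j with i <> j sum to 0, and |p_j - x_i| <= 1; hence both
   |M p_j + x_k| and |M p_j - x_k| are at most M for large M, so x_k = 0. *)
Lemma projections_sum1_orthogonal (n : nat) (p : 'I_n -> A) :
  (forall i, projection (p i)) -> \sum_i p i = 1 ->
  forall i j, i != j -> p i * p j = 0.
Proof.
move=> pp p1 k j kj.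
pose e := p j; have [es ee] : projection e := pp j.
pose x i := e * p i * e.
have xs i : star (x i) = x i.
  by have [ps _] := pp i; rewrite !starM es ps mulrA.
have ex i : e * x i = x i by rewrite /x !mulrA ee.
have xe i : x i * e = x i by rewrite /x -!mulrA ee.
have x0 : \sum_(i | i != j) x i = 0.
  have : \sum_i x i = e by rewrite -mulr_suml -mulr_sumr p1 mulr1 ee.
  rewrite (bigD1 j)//= => h; apply: (addrI e); rewrite addr0 -[RHS]h.
  by rewrite {2}/x -/e !ee.
have near i : `|e - x i| <= 1.
  have -> : e - x i = e * (1 - p i) * e by rewrite mulrBr mulr1 mulrBl ee.
  have p1n : `|1 - p i| <= 1.
    apply: projection_norm_le1; have [ps ppi] := pp i; split.
      by rewrite starB star1 ps.
    by rewrite mulrBl mul1r mulrBr mulr1 ppi subrr subr0.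
  have e1 : `|e| <= 1 by exact: projection_norm_le1.
  rewrite (le_trans (norm_mul_le _ _))// mulr_ile1//.
  by rewrite (le_trans (norm_mul_le _ _))// mulr_ile1.
have e1 : `|e| <= 1 by exact: projection_norm_le1.
(* For v = p_k p_j one has [star v * v] = x_k, so v vanishes with x_k. *)
suff xk : x k = 0.
  apply: star_mul_eq0; have [ps ppk] := pp k.
  by rewrite starM ps es mulrA -(mulrA e) ppk.
(* With M = N + 1, M e + x_k is e plus the N terms e - x_i for the remaining i, because the x_i sum
   to 0, while M e - x_k is N e plus e - x_k; e and all e - x_i have norm at most 1. *)
pose N := #|[pred i | (i != j) && (i != k)]|.
apply: (@corner_opp_bounded_eq0 e _ N.+1%:R) => //.
- have -> : N.+1%:R *: e + x k = e + \sum_(i | (i != j) && (i != k)) (e - x i).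
    rewrite sumrB sumr_const scaler_nat mulrS -addrA; congr (_ + (_ + _)).
    by move/eqP: x0; rewrite (bigD1 k)//= addr_eq0 => /eqP.
  rewrite (le_trans (ler_normD _ _))// -natr1 addrC lerD//.
  rewrite (le_trans (ler_norm_sum _ _ _))//.
  by rewrite (le_trans (ler_sum _ (fun i _ => near i)))// sumr_const.
- rewrite -natr1 scalerDl scale1r -addrA (le_trans (ler_normD _ _))// lerD//.
  by rewrite normrZ normr_nat ler_piMr.
Qed.

End OrthogonalProjections.

(** * Cylinders and the Markov shift *)

Section Cylinders.
Context {a : finType}.
Implicit Types (x y z : fullShift a) (k m : nat).

Definition agree k x y : Prop := forall m, (m < k)%N -> x m = y m.

Lemma agree_trans k x y z : agree k x y -> agree k y z -> agree k x z.
Proof. by move=> xy yz m mk; rewrite xy// yz. Qed.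

Lemma agree_le k m x y : (k <= m)%N -> agree m x y -> agree k x y.
Proof. by move=> km xy i ik; apply: xy; exact: leq_trans km. Qed.

Lemma agree_shift k x y : agree k.+1 x y -> agree k (Defs.shift x) (Defs.shift y).
Proof. by move=> xy i ik; exact: xy. Qed.

Let cyl_filter x : set_system (fullShift a) :=
  filter_from [set: nat] (fun k => agree k x).

Let cyl_filter_filter x : Filter (cyl_filter x).
Proof.
apply: filter_from_filter; first by exists 0%N.
move=> i j _ _; exists (maxn i j) => // z xz.
by split; apply: agree_le xz; rewrite ?leq_maxl ?leq_maxr.
Qed.

(** The product topology is a supremum over coordinates, so it suffices that a constraint on
    coordinate i follows from agreement on the first i + 1 letters. *)
Lemma nbhs_cylinder x (U : set (fullShift a)) :
  nbhs x U -> exists k, agree k x `<=` U.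
Proof.
have FF := cyl_filter_filter x.
suff cx : cyl_filter x --> x by move=> /cx[k _ xU]; exists k.
apply/cvg_sup => i; apply/cvg_image.
  by rewrite eqEsubset; split=> // b _; exists (fun=> b).
move=> U' /nbhs_singleton U'x; exists [set z | U' (z i)].
  by exists i.+1 => // z /= xz; rewrite -xz.
apply/seteqP; split=> [_ [z /= zU <-]//|b U'b].
by exists (fun=> b).
Qed.

Lemma cylinder_nbhs x k : nbhs x (agree k x).
Proof.
elim: k => [|k IH]; first by apply: filterS filterT.
have : nbhs x ((fun y : fullShift a => y k) @^-1` [set x k]).
  apply: (@proj_continuous _ (fun=> discrete_topology a) k).
  by apply: open_nbhs_nbhs; split=> //; exact: discrete_open.
apply: filterS2 IH => y xy /= yk m; rewrite ltnS leq_eqVlt => /orP[/eqP->|].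
  exact: esym yk.
exact: xy.
Qed.

Lemma fullShift_compact : compact [set: fullShift a].
Proof.
have ac (i : nat) : compact [set: discrete_topology a].
  by apply: finite_compact; exact: finite_finset.
have := @tychonoff nat (fun=> discrete_topology a) (fun=> setT) ac.
set B := (X in compact X -> _); suff -> : B = setT by [].
by apply/seteqP.
Qed.

End Cylinders.

Section UniformContinuity.
Context {R : realType} {a : finType} (X : shiftSpace a).
Implicit Types (f g : points X -> R[i]).

(** Uniform continuity for the cylinder metric: a single [k] serves the whole space. *)
Definition cyl_continuous f := forall e : R[i], 0 < e ->
  exists k, forall x y, agree k (val x) (val y) -> `|f x - f y| <= e.

Definition level k f := forall x y, agree k (val x) (val y) -> f x = f y.

Lemma level_continuous k f : level k f -> continuous (f : points X -> R[i]^o).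
Proof.
move=> fk x U fxU.
have cx : nbhs x (val @^-1` agree k (val x)).
  exact: (@initial_continuous _ _ (@set_val _ (shift_set X)) x _ (cylinder_nbhs _ _)).
apply: (@filterS _ (nbhs x) (nbhs_filter x) _ _ _ cx) => y /= xy.
by rewrite -(fk x y xy); exact: nbhs_singleton fxU.
Qed.

(** Each point has a cylinder on which f varies by at most e; compactness of X, in near-covering
    form, yields one length for all points. *)
Lemma continuous_cyl f : continuous (f : points X -> R[i]^o) -> cyl_continuous f.
Proof.
move=> fc e e0.
have Kc : compact (shift_set X).
  exact: subclosed_compact (@shift_closed _ X) fullShift_compact _.
have /compact_near_coveringP/near_covering_withinP cov := Kc.
pose P k (y : fullShift a) := forall x x' : points X,
  agree k y (val x) -> agree k y (val x') -> `|f x - f x'| <= e.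
suff /cov : forall y, shift_set X y ->
    \forall y' \near y & k \near \oo, shift_set X y' -> P k y'.
  move=> [k _ kP]; exists k => x x' xx'.
  by apply: (kP k (leqnn k) (val x)) => //; exact: set_valP.
move=> y Xy; pose x0 : points X := SigSub (mem_set Xy).
have e20 : 0 < e / 2 by rewrite divr_gt0.
have /cvgrPdist_lt/(_ _ e20) := fc x0.
move=> [_ [[W oW <-] Wx0 WU]].
have [k kW] := nbhs_cylinder (open_nbhs_nbhs (conj oW Wx0)).
exists (agree k y, [set j | (k <= j)%N]) => /=.
  by split; [exact: cylinder_nbhs|exists k].
move=> [y' j] [/= yy' kj] _ x x' yx yx'.
have near0 z : agree j y' (val z) -> `|f x0 - f z| < e / 2.
  move=> yz; apply: WU => /=; apply: kW.
  by apply: agree_trans yy' _; exact: agree_le yz.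
rewrite -(subrK (f x0) (f x)) -addrA (le_trans (ler_normD _ _))//.
by rewrite [leRHS](splitr e); apply: lerD; [rewrite distrC|]; apply/ltW/near0.
Qed.

End UniformContinuity.

Section MarkovShift.
Context {n : nat} (A : 'M[nat]_n).
Hypothesis A01 : forall i j, A i j = 0%N \/ A i j = 1%N.
Hypothesis A_rows : forall i, row i A != 0.
Local Notation X := (markov_shift A).
Local Notation Y := (fullShift 'I_n).
Implicit Types (x : points X) (y z : Y) (i j : 'I_n).

Definition successor i : 'I_n := odflt i [pick j | A i j == 1%N].

Lemma successorP i : A i (successor i) = 1%N.
Proof.
rewrite /successor; case: pickP => [j /eqP//|A0]; exfalso.
move/negP: (A_rows i); apply; apply/eqP/rowP => j; rewrite !mxE.
by have := A0 j; case: (A01 i j) => ->.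
Qed.

(** Letter k of the result depends only on letters 0 to k of [y], and points of X are left alone:
    this makes the map a continuous retraction onto X. *)
Fixpoint correct y k : 'I_n :=
  if k is m.+1 then
    if A (correct y m) (y m.+1) == 1%N then y m.+1 else successor (correct y m)
  else y 0%N.

Lemma correct_markov y : (correct y : Y) \in shift_set X.
Proof.
by rewrite inE => k /=; case: ifP => [/eqP//|_]; exact: successorP.
Qed.

Definition retract y : points X := SigSub (correct_markov y).

Lemma correct_agree k y z : agree k y z -> agree k (correct y : Y) (correct z).
Proof.
move=> yz; elim=> [|m IH] mk /=; first exact: yz.
by rewrite IH ?yz// ltnW.
Qed.

Lemma retract_val x : retract (val x) = x.
Proof.
apply: val_inj; apply/funext => /=; elim=> [//|k /= ->].
by have xX : shift_set X (val x) := set_valP x; rewrite xX eqxx.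
Qed.

Definition prepend i y : Y := fun k => if k is m.+1 then y m else i.

Lemma prepend_shift y : prepend (y 0%N) (Defs.shift y) = y.
Proof. by apply/funext => -[]. Qed.

Lemma agree_prepend k i y z :
  agree k y z -> agree k.+1 (prepend i y) (prepend i z).
Proof. by move=> yz [|m]//=; exact: yz. Qed.

(** An admissible first transition leaves y_0 in place, and from there on the corrections repeat
    those made on [y]. *)
Lemma correct_prepend i y k : A i (y 0%N) = 1%N ->
  correct (prepend i y) k.+1 = correct y k.
Proof. by move=> iy; elim: k => [|k IH] /=; [rewrite iy|rewrite -IH]. Qed.

Lemma sigma_retract_prepend i y : A i (y 0%N) = 1%N ->
  sigma (retract (prepend i y)) = retract y.
Proof.
by move=> iy; apply: val_inj; apply/funext => k; exact: correct_prepend.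
Qed.

Lemma retract_prepend_retract i y : A i (y 0%N) = 1%N ->
  retract (prepend i (val (retract y))) = retract (prepend i y).
Proof.
move=> iy; apply: val_inj; apply/funext => -[//|k].
rewrite [LHS](@correct_prepend i (correct y))// [RHS]correct_prepend//.
exact: (congr1 (fun x => val x k) (retract_val (retract y))).
Qed.

(** The inverse branch of [sigma] at the letter i where A(i, x_0) = 1; elsewhere the retraction only
    makes it total. *)
Definition branch i x : points X := retract (prepend i (val x)).

Lemma branch0 i x : val (branch i x) 0%N = i.
Proof. by []. Qed.

Lemma branch_sigma x : branch (val x 0%N) (sigma x) = x.
Proof. by rewrite /branch [X in retract X]prepend_shift retract_val. Qed.

Lemma sigma_branch i x : A i (val x 0%N) = 1%N -> sigma (branch i x) = x.
Proof. by move=> ix; rewrite sigma_retract_prepend// retract_val. Qed.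

Lemma markov_point x : A (val x 0%N) (val (sigma x) 0%N) = 1%N.
Proof. by have xX : shift_set X (val x) := set_valP x; exact: xX. Qed.

Lemma agree_branch k i x x' :
  agree k (val x) (val x') -> agree k.+1 (val (branch i x)) (val (branch i x')).
Proof. by move=> xx'; apply: correct_agree; exact: agree_prepend. Qed.

Definition indegree j : nat := #|[pred i | A i j == 1%N]|.

Section Transfer.
Context {R : realType}.
Implicit Types f : points X -> R[i].

(** The preimages of x are the branches at the letters that may precede x_0, and they differ in
    their first letter. If there are none, both sides are 0. *)
Lemma transfer_branchE f x : transfer_fun f x =
  (indegree (val x 0%N))%:R^-1 * \sum_(i | A i (val x 0%N) == 1%N) f (branch i x).
Proof.
rewrite transfer_funE.
set s := fset_set _; pose P := [pred i | A i (val x 0%N) == 1%N].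
have sE : perm_eq (s : seq (points X)) [seq branch i x | i <- enum P].
  apply: uniq_perm; first exact: fset_uniq.
    rewrite map_inj_uniq ?enum_uniq// => i j /(congr1 (fun x => val x 0%N)).
    by [].
  move=> z; rewrite in_fset_set; last exact: preimage_finite.
  apply/idP/mapP => [|[i iP ->]].
    rewrite inE => /= zx; exists (val z 0%N); last by rewrite -zx branch_sigma.
    by rewrite mem_enum inE -zx; apply/eqP; exact: markov_point.
  by move: iP; rewrite mem_enum !inE => /eqP/sigma_branch.
rewrite (perm_size sE) (perm_big _ sE)/= size_map -cardE big_map.
by rewrite big_enum_cond/=; congr (_ * _); apply: eq_bigl => i; rewrite andbT.
Qed.

End Transfer.

End MarkovShift.

(** * The algebra D_X of a Markov shift *)

Section MarkovAlgebra.
Context {R : realType} {n : nat} (A : 'M[nat]_n).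
Hypothesis A01 : forall i j, A i j = 0%N \/ A i j = 1%N.
Hypothesis A_rows : forall i, row i A != 0.
Local Notation X := (markov_shift A).
Local Notation P := (points (markov_shift A)).
Local Notation D := (@DX R 'I_n (markov_shift A)).
Local Notation alpha := (@DX_alpha R 'I_n (markov_shift A)).
Local Notation L := (@DX_transfer R 'I_n (markov_shift A)).
Local Notation branch := (branch A01 A_rows).
Local Notation retract := (retract A01 A_rows).
Implicit Types (x y : P) (i j : 'I_n) (f g : D) (c d : 'I_n -> R[i]).

Let cyl_linear (c : R[i]) (f g : bfun R P) :
  cyl_continuous f -> cyl_continuous g -> cyl_continuous (c *: f + g).
Proof.
move=> fc gc e e0.
have c0 : 0 < `|c| + 1 by rewrite ltr_wpDl.
have [k kf] := fc (e / 2 / (`|c| + 1)) (divr_gt0 (divr_gt0 e0 (ltr0Sn _ 1)) c0).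
have [m mg] := gc (e / 2) (divr_gt0 e0 (ltr0Sn _ 1)).
exists (maxn k m) => x y xy.
have xyk : agree k (val x) (val y) by apply: agree_le xy; exact: leq_maxl.
have xym : agree m (val x) (val y) by apply: agree_le xy; exact: leq_maxr.
rewrite !bfunDE !bfunZE opprD addrACA -mulrBr (le_trans (ler_normD _ _))//.
rewrite [leRHS](splitr e) lerD ?mg//.
apply: (@le_trans _ _ ((`|c| + 1) * `|f x - f y|)).
  by rewrite normrM ler_wpM2r// lerDl.
by rewrite mulrC -ler_pdivlMr// kf.
Qed.

Let cyl_mul (f g : bfun R P) :
  cyl_continuous f -> cyl_continuous g -> cyl_continuous (f * g).
Proof.
move=> fc gc e e0.
have M0 : 0 < `|f| + `|g| + 1 by rewrite ltr_wpDl// addr_ge0.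
have [k kf] := fc _ (divr_gt0 e0 M0).
have [m mg] := gc _ (divr_gt0 e0 M0).
exists (maxn k m) => x y xy.
have xyk : agree k (val x) (val y) by apply: agree_le xy; exact: leq_maxl.
have xym : agree m (val x) (val y) by apply: agree_le xy; exact: leq_maxr.
have -> : (f * g : bfun R P) x - (f * g : bfun R P) y =
    f x * (g x - g y) + (f x - f y) * g y.
  by rewrite [LHS](_ : _ = f x * g x - f y * g y)//; ring.
rewrite (le_trans (ler_normD _ _))// !normrM.
apply: (@le_trans _ _ ((`|f| + `|g|) * (e / (`|f| + `|g| + 1)))).
  rewrite mulrDl; apply: lerD; last rewrite mulrC.
    by apply: ler_pM; rewrite ?mg//; exact: bfun_norm_ge.
  by apply: ler_pM; rewrite ?kf//; exact: bfun_norm_ge.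
by rewrite mulrCA ler_piMr ?(ltW e0)// ler_pdivrMr// mul1r lerDl.
Qed.

Let cyl_closed : closed [set f : bfun R P | cyl_continuous f].
Proof.
move=> f fcl e e0; have e30 : 0 < e / 3 by rewrite divr_gt0.
have [g [/= gc fg]] := fcl _ (nbhsx_ballx f _ e30).
have {}fg x : `|f x - g x| <= e / 3.
  apply: le_trans (ltW _); last by move: fg; rewrite -ball_normE => /=; exact.
  exact: bfun_norm_ge (f - g) x.
have [k kg] := gc _ e30; exists k => x y xy.
have -> : f x - f y = (f x - g x) + (g x - g y) + (g y - f y) by ring.
have -> : e = e / 3 + e / 3 + e / 3 by field.
apply: le_trans (ler_normD _ _) _; apply: lerD; last by rewrite distrC.
by apply: le_trans (ler_normD _ _) _; rewrite lerD// kg.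
Qed.

(** D_X is the smallest algebra of its kind, so it is enough that the cylinder-continuous functions
    form one. Transfer preserves them because branches lengthen the agreement and the averaging
    weights depend on x_0 only. *)
Lemma DX_cyl_continuous f : cyl_continuous (subalg_val f).
Proof.
have Df : DX_set (subalg_val f) := subalgP f.
apply: (Df [set g : bfun R P | cyl_continuous g]).
split; last by move=> g; exact: continuous_cyl.
split; [split; [split|..]|..].
- by move=> e e0; exists 0%N => x y _; rewrite subrr normr0 ltW.
- by move=> c g h; exact: cyl_linear.
- exact: cyl_closed.
- by move=> g h; exact: cyl_mul.
- move=> g gc e e0; have [k kg] := gc e e0; exists k => x y xy.
  rewrite [X in `|X|](_ : _ = Num.conj (g x - g y)); last by rewrite rmorphB.
  by rewrite norm_conjC kg.
(* The extra letter gives x and y the same first letter even for k = 0, hence the same branches and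
   the same number of them. *)
- move=> g gc e e0; have [k kg] := gc e e0; exists k.+1 => x y xy.
  rewrite [bfun_transfer g x](transfer_branchE A01 A_rows).
  rewrite [bfun_transfer g y](transfer_branchE A01 A_rows).
  rewrite -(xy 0%N isT) -mulrBr -sumrB normrM normfV normr_nat.
  have [N0|N0] := eqVneq (indegree A (val x 0%N)) 0%N.
    by rewrite N0 invr0 mul0r ltW.
  rewrite ler_pdivrMl ?ltr0n ?lt0n// (le_trans (ler_norm_sum _ _ _))//.
  have ge i : `|g (branch i x) - g (branch i y)| <= e.
    apply: kg; apply: (agree_le (leqnSn k)); apply: agree_branch.
    exact: agree_le xy.
  apply: le_trans (ler_sum _ (fun i _ => ge i)) _.
  by rewrite sumr_const mulr_natl.
- move=> g gc e e0; have [k kg] := gc e e0; exists k.+1 => x y xy.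
  by apply: kg; exact: agree_shift.
Qed.

Lemma level_DX (f : bfun R P) k : level k f -> DX_set f.
Proof. by move=> fk V [_]; apply; exact: level_continuous fk. Qed.

Let letter_bounded c : (fun x : P => c (val x 0%N)) \in Defs.bounded_fun.
Proof.
apply/Defs.bounded_funP; exists (\sum_i cabs (c i)) => x.
rewrite cabsE lecR (bigD1 (val x 0%N))//= lerDl.
by rewrite sumr_ge0// => i _; exact: cabs_ge0.
Qed.

Let letter_level c : level 1 (BFun (letter_bounded c)).
Proof. by move=> x y xy /=; rewrite xy. Qed.

Definition letter c : D :=
  @Subalg _ _ (DX_subalg X) _ (mem_set (level_DX (@letter_level c))).

Lemma letterE c x : subalg_val (letter c) x = c (val x 0%N).
Proof. by []. Qed.

Definition first_letter i : D := letter (fun j => (j == i)%:R).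

Lemma letter1 : letter (fun=> 1) = 1.
Proof. exact: DX_ext. Qed.

Lemma letterM c d : letter c * letter d = letter (fun i => c i * d i).
Proof. exact: DX_ext. Qed.

Lemma DX_sumE (I : Type) (r : seq I) (Q : pred I) (F : I -> D) x :
  subalg_val (\sum_(i <- r | Q i) F i) x = \sum_(i <- r | Q i) subalg_val (F i) x.
Proof. by apply: (big_morph (fun f : D => subalg_val f x)). Qed.

Lemma DX_scaleE (c : R[i]) f x : subalg_val (c *: f) x = c * subalg_val f x.
Proof. by []. Qed.

Let DX_sum1E x (F : 'I_n -> D) :
  (forall i, i != val x 0%N -> subalg_val (F i) x = 0) ->
  subalg_val (\sum_i F i) x = subalg_val (F (val x 0%N)) x.
Proof. by move=> F0; rewrite DX_sumE (big_only1 (val x 0%N))// => i /F0. Qed.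

Lemma DX_mulC f g : f * g = g * f.
Proof. by apply: DX_ext => x; rewrite !DX_mulE mulrC. Qed.

Lemma letter_sumE c : letter c = \sum_i c i *: first_letter i.
Proof.
apply: DX_ext => x; rewrite DX_sum1E => [|i ix].
  by rewrite DX_scaleE !letterE eqxx mulr1.
by rewrite DX_scaleE letterE eq_sym (negbTE ix) mulr0.
Qed.

Lemma sum_first_letter : \sum_i first_letter i = 1.
Proof.
rewrite -letter1 letter_sumE.
by apply: eq_bigr => i _; rewrite scale1r.
Qed.

(** Repeating y_0 after position k makes the point depend on k + 1 letters only, with no choice of a
    tail letter; the retraction then returns it to X. *)
Let trunc k (y : fullShift 'I_n) : fullShift 'I_n :=
  fun m => y (if (m <= k)%N then m else 0%N).

Let truncK k y : agree k.+1 (val y) (val (retract (trunc k (val y)))).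
Proof.
rewrite -{1}(retract_val A01 A_rows y); apply: correct_agree => m.
by rewrite ltnS /trunc => ->.
Qed.

Let trunc_agree k x y : agree k.+1 (val x) (val y) ->
  trunc k (val x) = trunc k (val y).
Proof.
by move=> xy; apply/funext => m; rewrite /trunc; case: leqP => mk; apply: xy.
Qed.

Lemma DX_approx f (e : R[i]) : 0 < e ->
  exists k g, level k (subalg_val g) /\ `|f - g| <= e.
Proof.
move=> e0; have [k kf] := DX_cyl_continuous f e0.
have gb : (fun x : P => subalg_val f (retract (trunc k (val x)))) \in Defs.bounded_fun.
  have [M fM] := bfunP (subalg_val f); apply/Defs.bounded_funP; exists M => x.
  exact: fM.
have gk : level k.+1 (BFun gb) by move=> x y xy /=; rewrite (trunc_agree xy).
exists k.+1, (@Subalg _ _ (DX_subalg X) _ (mem_set (level_DX gk))); split => //.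
apply: bfun_norm_le (ltW e0) _ => x; apply: kf.
by apply: (agree_le (leqnSn k)); exact: truncK.
Qed.

(** A function g of k + 1 letters is the sum over i of [first_letter i] times alpha of x |-> g(ix),
    a function of k letters; induction on k reaches all functions of finitely many letters, and
    these are dense. *)
Lemma DX_ind (V : set D) : cstar_subalg V ->
  (forall i, V (first_letter i)) -> (forall f, V f -> V (alpha f)) ->
  forall f, V f.
Proof.
move=> [[V0 Vl Vc] VM VJ] Ve Va.
have VD f g : V f -> V g -> V (f + g).
  by move=> Vf Vg; have := Vl 1 f g Vf Vg; rewrite scale1r.
have VZ (c : R[i]) f : V f -> V (c *: f).
  by move=> Vf; have := Vl c f 0 Vf V0; rewrite addr0.
have Vs (F : 'I_n -> D) : (forall i, V (F i)) -> V (\sum_i F i).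
  by move=> VF; elim/big_ind : _ => // *; exact: VD.
have VL k (g : bfun R P) : level k g -> exists2 f : D, V f & subalg_val f = g.
  elim: k g => [|k IH] g gk.
    (* A function of no letters is constant, with its value taken at any point of X; if X is empty
       it is 0. *)
    have [[x0 _]|/set0P/negP/negPn/eqP P0] := pselect ([set: P] !=set0).
      exists (letter (fun=> g x0)); last by apply: bfunext => x; exact: gk.
      by rewrite letter_sumE; apply: Vs => i; exact: VZ.
    exists 0 => //; apply: bfunext => x.
    by have : [set: P] x by []; rewrite P0.
  have gb i : (fun x => g (branch i x)) \in Defs.bounded_fun.
    by have [M gM] := bfunP g; apply/Defs.bounded_funP; exists M.
  have gl i : level k (BFun (gb i)).
    by move=> x y xy; apply: gk; exact: agree_branch.
  have /choice[F FP] : forall i, exists f : D, V f /\ subalg_val f = BFun (gb i).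
    by move=> i; have [f Vf fE] := IH _ (gl i); exists f.
  exists (\sum_i first_letter i * alpha (F i)).
    by apply: Vs => i; apply: VM => //; apply: Va; have [] := FP i.
  apply: bfunext => x; rewrite DX_sum1E => [|i ix].
    have [_ FE] := FP (val x 0%N).
    rewrite DX_mulE letterE eqxx mul1r DX_alphaE FE /=.
    by rewrite branch_sigma.
  by rewrite DX_mulE letterE eq_sym (negbTE ix) mul0r.
move=> f; apply: Vc => B /nbhs_ballP[e e0 eB].
have e20 : 0 < e / 2 by rewrite divr_gt0.
have [k [g [gk fg]]] := DX_approx f e20.
have [h Vh hg] := VL k _ gk.
have {}hg : h = g by apply: DX_ext => x; rewrite hg.
exists g; split; first by rewrite -hg.
apply: eB; rewrite -ball_normE /=; apply: le_lt_trans fg _.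
by rewrite ltr_pdivrMr// ltr_pMr// ltr1n.
Qed.

End MarkovAlgebra.

(** * Representations from Cuntz-Krieger families *)

(** For d = s - s s^* s the product [star d * d] expands to 0, so d = 0 by the C*-identity. *)
Lemma partial_isometryK (R : realType) (B : cStarAlgType R) (s : B) :
  partial_isometry s -> s * (star s * s) = s.
Proof.
move=> [_ ss]; apply/eqP; rewrite eq_sym -subr_eq0; apply/eqP/star_mul_eq0.
have ps : star s * (s * (star s * s)) = star s * s by rewrite mulrA ss.
have es : star (s * (star s * s)) = star s * s * star s by rewrite !starM starK.
rewrite starB es mulrBl !mulrBr -!(mulrA _ (star s)) ps subrr.
by rewrite ss subrr subrr.
Qed.

Section CuntzKriegerFamily.
Context {R : realType} {n : nat} (A : 'M[nat]_n).
Hypothesis A01 : forall i j, A i j = 0%N \/ A i j = 1%N.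
Context {B : cStarAlgType R} (T : 'I_n -> B).
Hypothesis T_pisom : forall i, partial_isometry (T i).
Hypothesis T_sum : \sum_j T j * star (T j) = 1.
Hypothesis T_rel :
  forall i, star (T i) * T i = \sum_j (T j * star (T j)) *+ A i j.
Local Notation Y := (fullShift 'I_n).
Implicit Types (i j : 'I_n) (y z : Y) (F G : Y -> R[i]) (m k : nat).

Local Notation p i := (T i * star (T i)).

Lemma range_projection i : projection (p i).
Proof.
split; first by rewrite starM starK.
by rewrite mulrA -(mulrA (T i)) partial_isometryK.
Qed.

(** Orthogonality of the range projections comes from their sum being 1. *)
Lemma range_projectionT i j : p i * T j = if i == j then T j else 0.
Proof.
have pT (k : 'I_n) : p k * T k = T k by rewrite -mulrA partial_isometryK.
have [->|ij] := eqVneq i j; first exact: pT.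
rewrite -(pT j) mulrA.
by rewrite (projections_sum1_orthogonal range_projection T_sum ij) mul0r.
Qed.

Lemma starT_mulT i j : i != j -> star (T i) * T j = 0.
Proof.
move=> ij; have -> : T i = p i * T i by rewrite range_projectionT eqxx.
by rewrite starM (range_projection i).1 -mulrA range_projectionT (negbTE ij) mulr0.
Qed.

(** T_i absorbs its source projection, of which the relation leaves only the term A(i,j) T_j T_j^*
    in front of T_j: forbidden words vanish. *)
Lemma mulTT i j : T i * T j = (T i * T j) *+ A i j.
Proof.
rewrite -{1}(partial_isometryK (T_pisom i)) T_rel -mulrA mulr_suml.
rewrite (bigD1 j)//= big1 => [|k kj].
  by rewrite addr0 mulrnAl range_projectionT eqxx mulrnAr.
by rewrite mulrnAl range_projectionT (negbTE kj) mul0rn.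
Qed.

Variable i0 : 'I_n.

(* The sum of F(w i0 i0 i0 ..) T_w T_w^* over the words w of length m. *)
Fixpoint level_rep m F : B :=
  if m is m'.+1 then
    \sum_i T i * level_rep m' (fun y => F (prepend i y)) * star (T i)
  else F (fun=> i0) *: (1 : B).

Lemma level_rep_linear m (c : R[i]) F G :
  level_rep m (fun y => c * F y + G y) = c *: level_rep m F + level_rep m G.
Proof.
elim: m F G => [|m IH] F G /=; first by rewrite scalerDl csclA.
rewrite scaler_sumr -big_split; apply: eq_bigr => i _.
by rewrite IH mulrDr mulrDl csclAr csclAl.
Qed.

Lemma level_rep_const m (c : R[i]) : level_rep m (fun=> c) = c *: (1 : B).
Proof.
elim: m => [//|m IH]; rewrite -T_sum scaler_sumr [LHS]/=.
by apply: eq_bigr => i _; rewrite /= IH csclAr csclAl mulr1.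
Qed.

Lemma level_rep_sum m (I : Type) (r : seq I) (F : I -> Y -> R[i]) :
  level_rep m (fun y => \sum_(i <- r) F i y) = \sum_(i <- r) level_rep m (F i).
Proof.
elim: r => [|i r IH].
  rewrite big_nil -(scale0r (1 : B)) -(level_rep_const m); congr level_rep.
  by apply/funext => y; rewrite big_nil.
rewrite big_cons -IH -[level_rep m (F i)]scale1r -level_rep_linear.
by congr level_rep; apply/funext => y; rewrite big_cons mul1r.
Qed.

Lemma level_rep_star m F :
  star (level_rep m F) = level_rep m (fun y => Num.conj (F y)).
Proof.
elim: m F => [|m IH] F /=; first by rewrite starZ star1.
rewrite star_sum; apply: eq_bigr => i _.
by rewrite !starM starK IH mulrA.
Qed.

Lemma level_rep_mulT m F i :
  level_rep m.+1 F * T i =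
  T i * level_rep m (fun y => F (prepend i y)) * (star (T i) * T i).
Proof.
rewrite /= mulr_suml (bigD1 i)//= big1 ?addr0 ?mulrA// => j ji.
by rewrite -mulrA starT_mulT// mulr0.
Qed.

(** For m > 0 both sides keep only the block of words that start with j. By the Cuntz-Krieger
    relation, [level_rep] then commutes with the source projections too. *)
Lemma range_projection_level_rep m F j :
  p j * level_rep m F = level_rep m F * p j.
Proof.
have pTs : star (T j) * p j = star (T j).
  by have := congr1 star (partial_isometryK (T_pisom j)); rewrite !starM starK mulrA.
case: m => [|m] /=; first by rewrite csclAr csclAl mulr1 mul1r.
rewrite mulr_sumr mulr_suml; apply: eq_bigr => i _.
rewrite 2!mulrA range_projectionT -[RHS]mulrA.
have [ji|ji] := eqVneq j i; first by rewrite -ji pTs.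
by rewrite [star (T i) * _]mulrA starT_mulT 1?eq_sym// !mul0r mulr0.
Qed.

Lemma source_projection_level_rep m F i :
  star (T i) * T i * level_rep m F = level_rep m F * (star (T i) * T i).
Proof.
rewrite T_rel mulr_suml mulr_sumr; apply: eq_bigr => j _.
by rewrite mulrnAl mulrnAr range_projection_level_rep.
Qed.

(** The source projection left over by [level_rep_mulT] commutes with the shorter representation, so
    it moves next to T_i, which absorbs it. *)
Lemma level_rep_intertwine m F i :
  level_rep m.+1 F * T i = T i * level_rep m (fun y => F (prepend i y)).
Proof.
rewrite level_rep_mulT -mulrA -source_projection_level_rep mulrA.
by rewrite partial_isometryK.
Qed.

Lemma level_repM m F G :
  level_rep m F * level_rep m G = level_rep m (fun y => F y * G y).
Proof.
elim: m F G => [|m IH] F G; first by rewrite /= csclAr csclAl mulr1 csclA mulrC.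
rewrite [X in _ * X]/= [RHS]/= mulr_sumr; apply: eq_bigr => i _.
by rewrite !mulrA level_rep_intertwine -(mulrA (T i)) IH.
Qed.

(** Removing letters one by one leaves a constant function, whose image is the same scalar at every
    level because the range projections sum to 1. *)
Lemma level_rep_stable k m F :
  (forall y z, agree k y z -> F y = F z) -> (k <= m)%N ->
  level_rep m.+1 F = level_rep m F.
Proof.
elim: k m F => [|k IH] m F Fk km.
  have -> : F = fun=> F (fun=> i0) by apply/funext => y; exact: Fk.
  by rewrite !level_rep_const.
case: m km => // m km; rewrite [LHS]/= [RHS]/=.
apply: eq_bigr => i _; congr (_ * _ * _); apply: (IH m) => // y z yz.
by apply: Fk; exact: agree_prepend.
Qed.

(** T_i kills every block whose first letter j has A(i,j) = 0, so behind T_i the values that the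
    retraction creates after a forbidden transition are irrelevant. Level m + 1 makes the first
    letter visible. *)
Lemma level_rep_T_ext m i F G :
  (forall y, A i (y 0%N) = 1%N -> F y = G y) ->
  T i * level_rep m.+1 F = T i * level_rep m.+1 G.
Proof.
move=> FG /=; rewrite !mulr_sumr; apply: eq_bigr => j _.
rewrite !mulrA mulTT.
have [->|ij] := A01 i j; first by rewrite mulr0n !mul0r.
by congr (_ * _ * _); congr level_rep; apply/funext => y; exact: FG.
Qed.

Lemma level_rep_letter m (c : 'I_n -> R[i]) :
  level_rep m.+1 (fun y => c (y 0%N)) = \sum_i c i *: p i.
Proof.
by rewrite [LHS]/=; apply: eq_bigr => i _; rewrite level_rep_const csclAr csclAl mulr1.
Qed.

End CuntzKriegerFamily.

(** * The weights u_i *)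

Section WeightedLetters.
Context {R : realType} {n : nat} (A : 'M[nat]_n).
Hypothesis A01 : forall i j, A i j = 0%N \/ A i j = 1%N.
Hypothesis A_rows : forall i, row i A != 0.
Local Notation X := (markov_shift A).
Local Notation P := (points (markov_shift A)).
Local Notation D := (@DX R 'I_n (markov_shift A)).
Local Notation alpha := (@DX_alpha R 'I_n (markov_shift A)).
Local Notation L := (@DX_transfer R 'I_n (markov_shift A)).
Local Notation branch := (branch A01 A_rows).
Local Notation letter := (@letter R n A).
Local Notation first_letter := (@first_letter R n A).
Implicit Types (x : P) (i j : 'I_n) (f g : D).

Definition sqrt_indegree j : R[i] := sqrtC (indegree A j)%:R.

Lemma sqrt_indegree_sq j :
  sqrt_indegree j * sqrt_indegree j = (indegree A j)%:R.
Proof. by rewrite -expr2 sqrtCK. Qed.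

Lemma sqrt_indegree_conj j : conjc (sqrt_indegree j) = sqrt_indegree j.
Proof. by apply: (@conj_Creal R[i]); rewrite ger0_real// sqrtC_ge0. Qed.

Lemma indegree_neq0 i j : A i j = 1%N -> (indegree A j)%:R != 0 :> R[i].
Proof.
by move=> ij; rewrite pnatr_eq0 -lt0n; apply/card_gt0P; exists i; rewrite inE ij.
Qed.

Lemma sqrt_indegree_neq0 i j : A i j = 1%N -> sqrt_indegree j != 0.
Proof. by move=> ij; rewrite sqrtC_eq0 (indegree_neq0 ij). Qed.

(* The function u_i of the header: x |-> [x_0 = i] sqrt(N(x_1)). *)
Definition weight i : D := first_letter i * alpha (letter sqrt_indegree).

Lemma weightE i x : subalg_val (weight i) x =
  (val x 0%N == i)%:R * sqrt_indegree (val (sigma x) 0%N).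
Proof. by []. Qed.

(** Only branch i survives in the average, with factor sqrt(N) / N = 1 / sqrt(N) for N = N(x_0). *)
Lemma transfer_weight i f x : subalg_val (L (star (weight i) * f)) x =
  (A i (val x 0%N))%:R * (sqrt_indegree (val x 0%N))^-1 *
    subalg_val f (branch i x).
Proof.
rewrite DX_transferE (transfer_branchE A01 A_rows).
have [ix|ix] := A01 i (val x 0%N).
  rewrite big1 ?mulr0 ?ix ?mul0r// => j /eqP jx.
  rewrite DX_mulE DX_starE weightE branch0; case: eqP => [ji|_].
    by move: ix; rewrite -ji jx.
  by rewrite mul0r rmorph0 mul0r.
rewrite (big_only1 i) ?ix// => [|j ji _]; last first.
  rewrite DX_mulE DX_starE weightE branch0 (negbTE ji).
  by rewrite mul0r rmorph0 mul0r.
rewrite DX_mulE DX_starE weightE branch0 eqxx mul1r sigma_branch//.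
rewrite sqrt_indegree_conj mul1r mulrA -sqrt_indegree_sq invfM.
by rewrite -(mulrA _ _ (sqrt_indegree _)) mulVf ?mulr1// (sqrt_indegree_neq0 ix).
Qed.

Lemma transfer_weight_weight i :
  L (star (weight i) * weight i) = letter (fun j => (A i j)%:R).
Proof.
apply: DX_ext => x; rewrite transfer_weight letterE weightE branch0 eqxx mul1r.
have [->|ix] := A01 i (val x 0%N); first by rewrite !mul0r.
by rewrite sigma_branch// -mulrA mulVf ?mulr1// (sqrt_indegree_neq0 ix).
Qed.

(** The identity behind the redundancy of the header: moving S past functions turns u_i S S^* u_i^*
    f S into the left side times S. *)
Lemma weight_transfer i f :
  weight i * alpha (L (star (weight i) * f)) = first_letter i * f.
Proof.
apply: DX_ext => x; rewrite DX_mulE [RHS]DX_mulE weightE.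
rewrite DX_alphaE transfer_weight !letterE.
have [<-|_] := eqVneq (val x 0%N) i; last by rewrite !mul0r.
rewrite markov_point !mul1r branch_sigma mulrA mulfV ?mul1r//.
exact: sqrt_indegree_neq0 (markov_point x).
Qed.

Definition inv_sqrt_indegree j : R[i] := (sqrt_indegree j)^-1.

(** Serves to recover S from the u_i S; the division is legitimate because x_0 precedes x_1. *)
Lemma first_letter_weight i :
  first_letter i = alpha (letter inv_sqrt_indegree) * weight i.
Proof.
apply: DX_ext => x; rewrite DX_mulE DX_alphaE weightE !letterE mulrCA.
by rewrite mulVf ?mulr1//; exact: sqrt_indegree_neq0 (markov_point x).
Qed.

(** Where N(x_0) = 0 the transfer itself is 0; elsewhere the two inverse roots cancel N. *)
Lemma transfer_renormalize f :
  star (letter inv_sqrt_indegree) *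
    (letter (fun j => (indegree A j)%:R) * L f) * letter inv_sqrt_indegree = L f.
Proof.
apply: DX_ext => x; rewrite !DX_mulE DX_starE !letterE.
set j := val x 0%N; have [j0|j0] := eqVneq (indegree A j) 0%N.
  rewrite DX_transferE (transfer_branchE A01 A_rows) -/j j0.
  by rewrite mulr0n invr0 !(mul0r, mulr0).
have -> : conjc (inv_sqrt_indegree j) = inv_sqrt_indegree j.
  by apply: (@conj_Creal R[i]); rewrite realV ger0_real// sqrtC_ge0.
rewrite /inv_sqrt_indegree -sqrt_indegree_sq.
have s0 : sqrt_indegree j != 0 by rewrite sqrtC_eq0 pnatr_eq0.
by field.
Qed.

End WeightedLetters.

(** * The limit representation of D_X *)

Section Representation.
Context {R : realType} {n : nat} (A : 'M[nat]_n).
Hypothesis A01 : forall i j, A i j = 0%N \/ A i j = 1%N.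
Hypothesis A_rows : forall i, row i A != 0.
Context {B : cStarAlgType R} (T : 'I_n -> B).
Hypothesis T_pisom : forall i, partial_isometry (T i).
Hypothesis T_sum : \sum_j T j * star (T j) = 1.
Hypothesis T_rel :
  forall i, star (T i) * T i = \sum_j (T j * star (T j)) *+ A i j.
Variable i0 : 'I_n.
Local Notation X := (markov_shift A).
Local Notation P := (points (markov_shift A)).
Local Notation D := (@DX R 'I_n (markov_shift A)).
Local Notation alpha := (@DX_alpha R 'I_n (markov_shift A)).
Local Notation L := (@DX_transfer R 'I_n (markov_shift A)).
Local Notation branch := (branch A01 A_rows).
Local Notation retract := (retract A01 A_rows).
Local Notation letter := (@letter R n A).
Local Notation first_letter := (@first_letter R n A).
Local Notation weight := (@weight R n A).
Local Notation level_rep := (level_rep T i0).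
Implicit Types (x : P) (y z : fullShift 'I_n) (i j : 'I_n) (f g : D) (m k : nat).

Definition rep_at f m : B := level_rep m (fun y => subalg_val f (retract y)).

Lemma rep_at_hom m : star_hom (fun f => rep_at f m).
Proof.
split=> [c f g|f g|f].
- by rewrite /rep_at -level_rep_linear.
- by rewrite /rep_at (level_repM T_pisom T_sum T_rel).
- by rewrite /rep_at level_rep_star.
Qed.

Lemma rep_at_stable f k m (l : nat) : level k (subalg_val f) -> (k <= m)%N ->
  rep_at f (m + l) = rep_at f m.
Proof.
move=> fk km; elim: l => [|l IH]; first by rewrite addn0.
have Fk y z : agree k y z -> subalg_val f (retract y) = subalg_val f (retract z).
  by move=> yz; apply: fk; exact: correct_agree.
rewrite addnS -IH; exact: (level_rep_stable T_sum _ Fk (leq_trans km (leq_addr _ _))).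
Qed.

(** Contractivity bounds the error of replacing f by a function of finitely many letters uniformly
    in the level, and for that function the sequence is eventually constant. *)
Lemma rep_at_cvg f : cvg (rep_at f @ \oo).
Proof.
apply: cauchy_seq_cvg => e e0.
have e30 : 0 < e / 3 by rewrite divr_gt0.
have [k [g [gk fg]]] := DX_approx A01 A_rows f e30.
exists k => m km; rewrite -(subnKC km).
have close (l : nat) : `|rep_at f l - rep_at g l| <= e / 3.
  rewrite -(star_homB (rep_at_hom l)).
  exact: le_trans (star_hom_contractive (rep_at_hom l) _) fg.
have -> : rep_at f k - rep_at f (k + (m - k)) = (rep_at f k - rep_at g k) -
    (rep_at f (k + (m - k)) - rep_at g (k + (m - k))).
  by rewrite (rep_at_stable _ gk)// opprB addrA subrK.
apply: le_lt_trans (ler_normB _ _) _.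
apply: (@le_lt_trans _ _ (e / 3 + e / 3)); first exact: lerD.
by rewrite [ltRHS](_ : e = e / 3 + e / 3 + e / 3) ?ltrDl//; field.
Qed.

Definition rep f : B := lim (rep_at f @ \oo).

Lemma rep_cvg f : rep_at f @ \oo --> rep f.
Proof. exact: rep_at_cvg. Qed.
Arguments rep_cvg : clear implicits.

Lemma rep_unique f b : rep_at f @ \oo --> b -> rep f = b.
Proof. by move=> fb; exact: norm_cvg_unique (rep_cvg f) fb. Qed.

Lemma rep_hom : star_hom rep.
Proof.
split=> [c f g|f g|f]; apply: rep_unique.
- rewrite (_ : rep_at _ = fun m => c *: rep_at f m + rep_at g m); last first.
    by apply/funext => m; have [h _ _] := rep_at_hom m; exact: h.
  by apply: cvgD; [apply: cvgZl_tmp|]; exact: rep_cvg.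
- rewrite (_ : rep_at _ = fun m => rep_at f m * rep_at g m); last first.
    by apply/funext => m; exact: (star_homM (rep_at_hom m)).
  by apply: cvg_cmul; exact: rep_cvg.
- rewrite (_ : rep_at _ = fun m => star (rep_at f m)); last first.
    by apply/funext => m; exact: (star_homJ (rep_at_hom m)).
  by apply: cvg_star; exact: rep_cvg.
Qed.

Lemma rep_letter (c : 'I_n -> R[i]) : rep (letter c) = \sum_i c i *: (T i * star (T i)).
Proof.
apply: rep_unique; rewrite -cvg_shiftS.
rewrite (_ : (fun m => _) = cst (\sum_i c i *: (T i * star (T i)))).
  exact: cvg_cst.
by apply/funext => m; exact: level_rep_letter.
Qed.

Lemma rep1 : rep 1 = 1.
Proof.
rewrite -letter1 rep_letter -T_sum.
by apply: eq_bigr => i _; rewrite scale1r.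
Qed.

Lemma rep_first_letter i : rep (first_letter i) = T i * star (T i).
Proof.
rewrite rep_letter (bigD1 i)//= big1 => [|j ji].
  by rewrite eqxx scale1r addr0.
by rewrite (negbTE ji) scale0r.
Qed.

Let cvgMT (u : nat -> B) (b c : B) :
  u @ \oo --> b -> (fun m => u m * c) @ \oo --> b * c.
Proof. by move=> ub; apply: cvg_cmul ub _; exact: cvg_cst. Qed.

Let cvgTM (u : nat -> B) (b c : B) :
  u @ \oo --> b -> (fun m => c * u m) @ \oo --> c * b.
Proof. by move=> ub; apply: cvg_cmul _ ub; exact: cvg_cst. Qed.

Let cvgS (u : nat -> B) (b : B) k : u @ \oo --> b -> (fun m => u (m + k)%N) @ \oo --> b.
Proof. by move=> ub; rewrite cvg_shiftn. Qed.

Lemma rep_T_ext i f g :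
  (forall x, A i (val x 0%N) = 1%N -> subalg_val f x = subalg_val g x) ->
  T i * rep f = T i * rep g.
Proof.
move=> fg; have cf := cvgTM (c := T i) (cvgS 1 (rep_cvg f)).
apply: (norm_cvg_unique cf).
rewrite (_ : (fun m => _) = fun m => T i * rep_at g (m + 1)).
  exact: cvgTM (cvgS 1 (rep_cvg g)).
apply/funext => m; rewrite addn1.
by apply: (level_rep_T_ext A01 T_pisom T_sum T_rel) => y iy; exact: fg.
Qed.

(** Level m + 1 on the left meets level m + 2 on the right, as T_i takes away one letter. Behind T_i
    only sequences y with A(i, y_0) = 1 count, and there [sigma] undoes the prepending. *)
Lemma rep_intertwine f i : T i * rep f = rep (alpha f) * T i.
Proof.
have cf := cvgTM (c := T i) (cvgS 1 (rep_cvg f)).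
apply: (norm_cvg_unique cf).
rewrite (_ : (fun m => _) = fun m => rep_at (alpha f) (m + 2) * T i).
  exact: cvgMT (cvgS 2 (rep_cvg _)).
apply/funext => m; rewrite addn1 addn2 /rep_at.
rewrite (level_rep_intertwine T_pisom T_sum T_rel).
apply: (level_rep_T_ext A01 T_pisom T_sum T_rel) => y iy.
by rewrite DX_alphaE sigma_retract_prepend.
Qed.

(** Conjugation by T_i gives the source projection times the image of y |-> f(iy), that is, the
    image of A(i, y_0) f(iy); the sum over i is N times the average defining L. *)
Lemma rep_transfer f :
  \sum_i star (T i) * rep f * T i =
  rep (letter (fun j => (indegree A j)%:R) * L f).
Proof.
have cf : (fun m => \sum_i star (T i) * rep_at f (m + 2) * T i) @ \oo -->
    \sum_i star (T i) * rep f * T i.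
  apply: cvg_big => [|i _]; first exact: add_continuous.
  by apply: cvgMT; apply: cvgTM; exact: cvgS 2 (rep_cvg f).
apply: (norm_cvg_unique cf).
rewrite (_ : (fun m => _) = fun m =>
    rep_at (letter (fun j => (indegree A j)%:R) * L f) (m + 1)).
  exact: cvgS 1 (rep_cvg _).
apply/funext => m; rewrite addn1 addn2 /rep_at.
have -> : (fun y => subalg_val (letter (fun j => (indegree A j)%:R) * L f) (retract y)) =
    fun y => \sum_i (A i (y 0%N))%:R * subalg_val f (retract (prepend i y)).
  apply/funext => y; rewrite DX_mulE letterE DX_transferE.
  rewrite (transfer_branchE A01 A_rows) [val (retract y) 0%N]/=.
  have -> : \sum_i (A i (y 0%N))%:R * subalg_val f (retract (prepend i y)) =
      \sum_(i | A i (y 0%N) == 1%N) subalg_val f (branch i (retract y)).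
    rewrite [RHS]big_mkcond; apply: eq_bigr => i _.
    have [->|iy] := A01 i (y 0%N); first by rewrite mul0r.
    by rewrite iy eqxx mul1r /branch retract_prepend_retract.
  have [y0|y0] := eqVneq (indegree A (y 0%N)) 0%N.
    rewrite y0 mul0r big1// => i iy; exfalso.
    by move/eqP: y0; rewrite -leqn0 leqNgt => /negP; apply; apply/card_gt0P; exists i.
  by rewrite mulrA mulfV ?mul1r// pnatr_eq0.
rewrite (level_rep_sum T_sum); apply: eq_bigr => i _.
rewrite -mulrA (level_rep_intertwine T_pisom T_sum T_rel) mulrA T_rel.
rewrite -(level_repM T_pisom T_sum T_rel); congr (_ * _).
rewrite (level_rep_letter T_sum i0 m (fun j => (A i j)%:R)).
by apply: eq_bigr => j _; rewrite scaler_nat.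
Qed.

Definition rep_shift : B := \sum_i T i * rep (letter (@inv_sqrt_indegree R n A)).

Lemma rep_toeplitz : @toeplitz_relations R (shift_system R X) B rep rep_shift.
Proof.
have h := rep_hom.
split=> // [|f|f]; first exact: rep1.
  rewrite /rep_shift mulr_suml mulr_sumr; apply: eq_bigr => i _.
  by rewrite -mulrA -(star_homM h) DX_mulC (star_homM h) !mulrA rep_intertwine.
rewrite /rep_shift; set w := letter _.
have -> : \sum_i T i * rep w = (\sum_i T i) * rep w by rewrite mulr_suml.
rewrite starM star_sum -!mulrA.
(* D_X is commutative, so [rep f] commutes with the range projections, which are images of first
   letters; the cross terms vanish. *)
have off i j : i != j -> star (T i) * (rep f * T j) = 0.
  move=> ij; have -> : star (T i) = star (T i) * (T i * star (T i)).
    have := congr1 star (partial_isometryK (T_pisom i)).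
    by rewrite !starM starK mulrA => ->.
  rewrite -(rep_first_letter i) -mulrA (mulrA (rep _)) -(star_homM h) DX_mulC.
  rewrite (star_homM h) -mulrA rep_first_letter.
  by rewrite (range_projectionT T_pisom T_sum) (negbTE ij) !mulr0.
have -> : (\sum_i star (T i)) * (rep f * ((\sum_i T i) * rep w)) =
    (\sum_i star (T i) * rep f * T i) * rep w.
  rewrite (mulrA (rep f)) mulrA; congr (_ * _).
  rewrite mulr_suml; apply: eq_bigr => i _.
  rewrite mulr_sumr mulr_sumr (bigD1 i)//= big1 => [|j ji].
    by rewrite addr0 mulrA.
  by rewrite off// eq_sym.
rewrite rep_transfer -(star_homJ h) -!(star_homM h) mulrA.
by rewrite (transfer_renormalize A01 A_rows).
Qed.

(** Moved past s, the factor sqrt(N(x_1)) becomes sqrt(N(x_0)) and cancels the N^(-1/2) built into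
    s; behind T_i only points with N(x_0) > 0 count. *)
Lemma rep_weight i : rep (weight i) * rep_shift = T i.
Proof.
have h := rep_hom.
have [_ _ ts _] := rep_toeplitz.
rewrite (star_homM h) -mulrA -[rep (alpha _) * _]ts /rep_shift.
rewrite mulr_suml mulr_sumr (bigD1 i)//= big1 => [|j ji]; last first.
  rewrite rep_first_letter !mulrA (range_projectionT T_pisom T_sum).
  by rewrite eq_sym (negbTE ji) !mul0r.
rewrite addr0 rep_first_letter !mulrA (range_projectionT T_pisom T_sum) eqxx.
rewrite -mulrA -(star_homM h) -[RHS]mulr1 -rep1; apply: rep_T_ext => x ix.
by rewrite letterM letterE mulVf// (sqrt_indegree_neq0 ix).
Qed.

(** The two elements have the same product with every T_i = rho(u_i) s, hence with the sum of the
    range projections, which is 1. *)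
Lemma rep_shift_cancel (b b' : B) :
  (forall f, b * rep f * rep_shift = b' * rep f * rep_shift) -> b = b'.
Proof.
move=> bb; rewrite -[LHS]mulr1 -[RHS]mulr1 -T_sum !mulr_sumr.
by apply: eq_bigr => i _; rewrite -(rep_weight i) !mulrA bb.
Qed.

End Representation.

(** * The crossed product *)

Lemma cstar_generated_subalg (R : realType) (B : cStarAlgType R) (G : set B) :
  cstar_subalg (cstar_generated G).
Proof.
split; [split|..].
- by move=> V [[[V0 _ _] _ _] _].
- move=> c x y Gx Gy V [VV GV]; have [[_ Vl _] _ _] := VV.
  by apply: Vl; [exact: Gx|exact: Gy].
- by apply: closed_bigI => V [[[_ _ Vc] _ _] _].
- move=> x y Gx Gy V [VV GV]; have [_ VM _] := VV.
  by apply: VM; [exact: Gx|exact: Gy].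
- by move=> x Gx V [VV GV]; have [_ _ VJ] := VV; apply: VJ; exact: Gx.
Qed.

Section CrossedProductGenerators.
Context {R : realType} {n : nat} (A : 'M[nat]_n).
Hypothesis A01 : forall i j, A i j = 0%N \/ A i j = 1%N.
Hypothesis A_rows : forall i, row i A != 0.
Local Notation X := (markov_shift A).
Local Notation D := (shift_system R (markov_shift A)).
Local Notation alpha := (@DX_alpha R 'I_n (markov_shift A)).
Local Notation L := (@DX_transfer R 'I_n (markov_shift A)).
Local Notation letter := (@letter R n A).
Local Notation first_letter := (@first_letter R n A).
Local Notation weight := (@weight R n A).
Implicit Types (i j : 'I_n) (f g : @DX R 'I_n (markov_shift A)).
Context {T Q : cStarAlgType R} (iota : D -> T) (S : T) (q : T -> Q).
Hypothesis T_rel : toeplitz_relations iota S.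
Hypothesis T_gen : cstar_generated (range iota `|` [set S]) = setT.
Hypothesis q_hom : star_hom q.
Hypothesis q_surj : range q = setT.
Hypothesis q_ker : forall x, q x = 0 <-> redundancy_ideal iota S x.

Let iota_hom : star_hom iota. Proof. by case: T_rel. Qed.

Let iota1 : iota 1 = 1. Proof. by case: T_rel. Qed.

Let S_iota f : S * iota f = iota (alpha f) * S.
Proof. by have [_ _ h _] := T_rel; exact: h. Qed.

Let S_iota_S f : star S * iota f * S = iota (L f).
Proof. by have [_ _ _ h] := T_rel; exact: h. Qed.

Let kappa f : Q := q (iota f).

Let kappa_hom : star_hom kappa.
Proof.
split=> [c f g|f g|f].
- by have [il _ _] := iota_hom; have [ql _ _] := q_hom; rewrite /kappa il ql.
- by rewrite /kappa (star_homM iota_hom) (star_homM q_hom).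
- by rewrite /kappa (star_homJ iota_hom) (star_homJ q_hom).
Qed.

Definition generator i : Q := q (iota (weight i) * S).

(** Surjectivity makes [q 1] act as a unit on the whole quotient. *)
Lemma q1 : q 1 = 1.
Proof.
have : range q 1 by rewrite q_surj.
by move=> [t _ qt]; rewrite -[LHS]mulr1 -[X in _ * X]qt -(star_homM q_hom) mul1r qt.
Qed.

Lemma kappa1 : q (iota 1) = 1.
Proof. by rewrite iota1 q1. Qed.

Lemma generator_source i :
  star (generator i) * generator i = q (iota (letter (fun j => (A i j)%:R))).
Proof.
rewrite -(star_homJ q_hom) -(star_homM q_hom) starM -!mulrA.
rewrite (mulrA (star (iota _))) -(star_homJ iota_hom) -(star_homM iota_hom).
by rewrite mulrA S_iota_S (transfer_weight_weight A01 A_rows).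
Qed.

Lemma generator_range i :
  generator i * star (generator i) = q (iota (first_letter i)).
Proof.
apply/esym/eqP; rewrite -subr_eq0 -(star_homJ q_hom) -(star_homM q_hom).
rewrite -(star_homB q_hom) starM -(star_homJ iota_hom) mulrA.
apply/eqP/q_ker => V [VV]; apply.
exists (first_letter i).
exists (iota (weight i) * S * star S * iota (star (weight i))); split => //.
(* S^* u_i^* f S is L(u_i^* f), and S moves past it, so k f S becomes u_i alpha(L(u_i^* f)) S, which
   is 1_[i] f S. *)
- split=> [W [WW]|f]; first by apply; exists (weight i), (star (weight i)).
  rewrite -(star_homM iota_hom) -(weight_transfer A01 A_rows).
  rewrite (star_homM iota_hom (weight i)) -[LHS]mulrA -S_iota -S_iota_S.
  by rewrite (star_homM iota_hom (star _)) !mulrA.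
(* Membership in the span of D alpha(D) D holds because alpha fixes 1. *)
- move=> W [WW]; apply; exists (first_letter i), 1, 1.
  by rewrite mulr1 [exel_alpha _](_ : _ = 1) ?mulr1//; exact: DX_ext.
Qed.

Lemma generator_sum : \sum_j generator j * star (generator j) = 1.
Proof.
rewrite -kappa1 -[RHS]/(kappa 1) -sum_first_letter (star_hom_sum kappa_hom).
by apply: eq_bigr => j _; rewrite generator_range.
Qed.

Lemma generator_relation i : star (generator i) * generator i =
  \sum_j (generator j * star (generator j)) *+ A i j.
Proof.
rewrite generator_source -[LHS]/(kappa _) letter_sumE (star_hom_sum kappa_hom).
apply: eq_bigr => j _; rewrite generator_range (star_homZ kappa_hom).
exact: scaler_nat.
Qed.

Lemma generator_partial_isometry i : partial_isometry (generator i).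
Proof.
rewrite /partial_isometry generator_source -/(kappa _); split.
  rewrite -(star_homJ kappa_hom); congr kappa.
  by apply: DX_ext => x; rewrite DX_starE letterE; exact: rmorph_nat.
rewrite -(star_homM kappa_hom) letterM; congr (kappa (letter _)).
by apply/funext => j; case: (A01 i j) => ->; rewrite ?mulr0 ?mulr1.
Qed.

(** Functions are reached since 1_[i] = S_i S_i^* and alpha(f) is the sum of the S_i f S_i^* in the
    quotient; the image of S is the sum of the alpha(N^(-1/2)) S_i. *)
Lemma generator_generate : cstar_generated (range generator) = setT.
Proof.
set W := cstar_generated _.
have Wsub : cstar_subalg W := cstar_generated_subalg _.
have [[W0 Wl _] WM WJ] := Wsub.
have WD x y : W x -> W y -> W (x + y).
  by move=> Wx Wy; have := Wl 1 x y Wx Wy; rewrite scale1r.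
have Wsum (F : 'I_n -> Q) : (forall i, W (F i)) -> W (\sum_i F i).
  by move=> WF; elim/big_ind : _ => // *; exact: WD.
have Wg i : W (generator i) by move=> V [_]; apply; exists i.
have We i : W (kappa (first_letter i)).
  by rewrite /kappa -generator_range; apply: WM => //; exact: WJ.
have Wk f : W (kappa f).
  apply: (DX_ind A01 A_rows (V := kappa @^-1` W)) => //.
    exact: star_hom_preimage_subalg.
  move=> {}f /= Wf; rewrite -[alpha f]mulr1 -sum_first_letter mulr_sumr.
  rewrite (star_hom_sum kappa_hom); apply: Wsum => i.
  rewrite (star_homM kappa_hom) [kappa (first_letter i)]/kappa -generator_range.
  rewrite mulrA.
  suff -> : kappa (alpha f) * generator i = generator i * kappa f.
    by apply: (WM); [exact: WM|exact: WJ].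
  rewrite /kappa /generator -!(star_homM q_hom) -[X in _ = q X]mulrA.
  rewrite S_iota !mulrA -!(star_homM iota_hom).
  by rewrite DX_mulC.
have WS : W (q S).
  rewrite -[S]mul1r -iota1 -sum_first_letter (star_hom_sum iota_hom).
  rewrite mulr_suml (star_hom_sum q_hom); apply: Wsum => i.
  rewrite first_letter_weight (star_homM iota_hom) -mulrA.
  by rewrite (star_homM q_hom); apply: WM; [exact: Wk|exact: Wg].
apply/seteqP; split=> // x _; have : range q x by rewrite q_surj.
move=> [t _ <-].
have Gt : cstar_generated (range iota `|` [set S]) t by rewrite T_gen.
apply: (Gt (q @^-1` W)); split; first exact: star_hom_preimage_subalg q_hom _ Wsub.
by move=> _ [[f _ <-]|->]; [exact: Wk|exact: WS].
Qed.

End CrossedProductGenerators.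

(** * Passing to the quotient *)

Lemma factor_through_surjection (R : realType) (T Q B : cStarAlgType R)
    (q : T -> Q) (phi : T -> B) :
  star_hom q -> range q = setT -> star_hom phi ->
  (forall t, q t = 0 -> phi t = 0) ->
  exists2 psi : Q -> B, star_hom psi & forall t, psi (q t) = phi t.
Proof.
move=> qh qs ph q0.
have /choice[sec secE] : forall x, exists t, q t = x.
  by move=> x; have : range q x by [rewrite qs]; move=> [t _ <-]; exists t.
have wd t t' : q t = q t' -> phi t = phi t'.
  move=> tt; apply/eqP; rewrite -subr_eq0 -(star_homB ph); apply/eqP/q0.
  by rewrite (star_homB qh) tt subrr.
exists (phi \o sec) => [|t /=]; last by apply: wd; rewrite secE.
have [pl pM pJ] := ph; have [ql qM qJ] := qh.
split=> [c x y|x y|x] /=; rewrite -?pl -?pM -?pJ; apply: wd.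
- by rewrite ql !secE.
- by rewrite qM !secE.
- by rewrite qJ !secE.
Qed.

(** The kernel of [phi] is a closed ideal, so only the generators a - k matter; the identity
    defining a redundancy is exactly what the cancellation hypothesis consumes. *)
Lemma redundancy_ideal_kernel (R : realType) (D : exelSystem R)
    (T B : cStarAlgType R) (iota : D -> T) (S : T) (phi : T -> B) :
  star_hom phi ->
  (forall b b' : B, (forall f, b * phi (iota f) * phi S = b' * phi (iota f) * phi S) ->
     b = b') ->
  forall t, redundancy_ideal iota S t -> phi t = 0.
Proof.
move=> ph cancel t It; apply: (It [set x | phi x = 0]); split.
  exact: star_hom_kernel_ideal.
move=> _ [a [k [[_ ak] _ ->]]] /=; rewrite (star_homB ph); apply/eqP.
rewrite subr_eq0; apply/eqP; apply: cancel => f.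
by rewrite -!(star_homM ph) ak.
Qed.

Theorem theorem12 (R : realType) (n : nat) (A : 'M[nat]_n)
    (A01 : forall i j, A i j = 0%N \/ A i j = 1%N)
    (A_rows : forall i, row i A != 0)
    (Q : cStarAlgType R)
    (Q_crossed : is_crossed_product (shift_system R (markov_shift A)) Q) :
  exists S : 'I_n -> Q,
    [/\ forall i, partial_isometry (S i),
        cstar_generated (range S) = setT,
        \sum_j S j * star (S j) = 1,
        forall i, star (S i) * S i = \sum_j (S j * star (S j)) *+ A i j
      & forall (B : cStarAlgType R) (T : 'I_n -> B),
          (forall i, partial_isometry (T i)) ->
          \sum_j T j * star (T j) = 1 ->
          (forall i, star (T i) * T i = \sum_j (T j * star (T j)) *+ A i j) ->
          exists phi : Q -> B, star_hom phi /\ forall i, phi (S i) = T i].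
Proof.
have [T [iota [S [q [[T_rel T_gen T_univ] q_hom q_surj q_ker]]]]] := Q_crossed.
exists (generator iota S q); split.
- exact: generator_partial_isometry.
- exact: generator_generate.
- exact: generator_sum.
- exact: generator_relation.
move=> B V V_pisom V_sum V_rel.
(* An empty alphabet offers no tail letter for the representation; the zero map then works, the
   condition on the generators being vacuous. *)
have [i0|no_letter] := pickP (@predT 'I_n); last first.
  exists (fun=> 0); split; last by move=> i; have := no_letter i.
  by split=> [c x y|x y|x] /=; rewrite ?scaler0 ?addr0 ?mul0r ?star0.
move=> _; have rel := rep_toeplitz A01 A_rows V_pisom V_sum V_rel i0.
have [phi [phi_hom _ phi_iota phi_S]] := T_univ _ _ _ rel.
have [] := @factor_through_surjection _ _ _ _ q phi q_hom q_surj phi_hom.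
  move=> t /q_ker; apply: redundancy_ideal_kernel => // b b' bb.
  apply: (@rep_shift_cancel _ _ _ A01 A_rows _ _ V_pisom V_sum V_rel i0) => f.
  by have := bb f; rewrite phi_iota phi_S.
move=> psi psi_hom psiE; exists psi; split=> // i.
rewrite psiE (star_homM phi_hom) phi_iota phi_S.
exact: (rep_weight A01 A_rows V_pisom V_sum V_rel).
Qed.
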